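(* For every $\alpha>0$ there exists $n_0\in\mathbb{N}$ such that for all integers $n\geq n_0$ the following holds. If $H=([n],E)$ is a $3$-uniform hypergraph with $d(i,j)\geq \min\left(i,j,\frac{n}{2}\right)+\alpha n$ for all pairs $\{i,j\}\in[n]^{(2)}$, then $H$ contains a tight Hamiltonian cycle.
   Context: A $3$-uniform hypergraph (3-graph) is a pair $(V,E)$ with $E\subseteq V^{(3)}$ (the $3$-element subsets of $V$). Vertices are the integers $[n]=\{1,\dots,n\}$ and are compared as integers. For distinct vertices $v,w$, the pair degree is $d(v,w)=|\{x\in V: \{v,w,x\}\in E\}|$. A tight path of length $\ell$ is a 3-graph on $\ell+2$ distinct vertices $x_1,\dots,x_{\ell+2}$ with edge set $\{x_ix_{i+1}x_{i+2}: i\in[\ell]\}$. A tight cycle of length $\ell\geq 4$ consists of a tight path $x_1,\dots,x_\ell$ together with the edges $x_{\ell-1}x_\ell x_1$ and $x_\ell x_1x_2$. A tight Hamiltonian cycle of $H$ is a tight cycle in $H$ containing all vertices of $H$. *)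

(* Defs.v *)
From HB Require Import structures.
From mathcomp Require Import all_boot all_order all_algebra.
From mathcomp Require Import reals.
Set Implicit Arguments. Unset Strict Implicit. Unset Printing Implicit Defensive.
Import Order.TTheory GRing.Theory Num.Theory.

(* Vertex k : 'I_n represents the integer k+1 of [n] = {1,...,n}. *)

Definition is_3graph (n : nat) (E : {set {set 'I_n}}) : Prop :=
  forall e, e \in E -> #|e| = 3.

Definition pair_deg (n : nat) (E : {set {set 'I_n}}) (v w : 'I_n) : nat :=
  #|[set x : 'I_n | [set v; w; x] \in E]|.

Definition tight_ham_cycle (n : nat) (E : {set {set 'I_n}}) : Prop :=
  exists s : seq 'I_n,
    [/\ 4 <= n, uniq s, size s = n &
      forall (x0 : 'I_n) (i : nat), i < n ->
        [set nth x0 s i; nth x0 s ((i + 1) %% n); nth x0 s ((i + 2) %% n)] \in E].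

(* Main.v *)
Require Import Defs.
From HB Require Import structures.
From mathcomp Require Import all_boot all_order all_algebra.
From mathcomp Require Import reals.
From mathcomp Require Import zify ring.
Set Implicit Arguments. Unset Strict Implicit. Unset Printing Implicit Defensive.
Import Order.TTheory GRing.Theory Num.Theory.

(** Absorbing method, with counting in place of randomness. Write [U] for the
vertices of index at least [n/2]. Two pairs inside [U] are joined by a positive
proportion of all 7-tuples, and any pair climbs into [U] in boundedly many
steps, each gaining [f ~ alpha n] in index; so any two pairs are joined by a
positive proportion of all tuples of a fixed length. A vertex [u] of [U] is
absorbed by a path of length 3 of its link; a lower vertex [v] is first
exchanged for a higher one [u], along a path of length 3 in the common link
of [v] and [u], and boundedly many exchanges end in [U]. A greedy choice driven by the
weights [2 ^ -count] turns such positive proportions into linearly many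
disjoint tuples that serve every index many times.

Almost all vertices are covered by disjoint complete tripartite 3-graphs of
large constant part size, which contain spanning tight paths. Such a tiling
is improved along the potential [sum (2K - grade)] of the uncovered vertices:
for two uncovered clusters of equal grade, the degree condition yields an
uncovered cluster spanning many edges with them, or a tile with two such
clusters, or a tile with one such cluster whose other two clusters have higher
grade. In each case the Kovari-Sos-Turan argument yields smaller tiles that
lower the potential by a constant proportion, so after boundedly many rounds
almost nothing is uncovered. *)
(** * Tight paths and counting of words *)

(* [lia] alone does not identify convertible but distinct counts. *)
Ltac count_lia :=
  repeat match goal with |- context [@count ?T ?p ?s] =>
    let c := fresh "c" in move: (@count T p s) => c end;
  repeat match goal with |- context [@size ?T ?s] =>
    let c := fresh "c" in move: (@size T s) => c end; clear; lia.

Section TightPaths.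
Variables (V : eqType) (e : V -> V -> V -> bool).

Fixpoint tpath (s : seq V) : bool :=
  match s with
  | x :: ((y :: z :: _) as s') => e x y z && tpath s'
  | _ => true
  end.

(** An edge spans three consecutive entries, so none has vertices on both sides of the pair [x y]:
    paths may be cut and joined at any consecutive pair. *)
Lemma tpath_glue s x y t :
  tpath (s ++ x :: y :: t) = tpath (s ++ [:: x; y]) && tpath (x :: y :: t).
Proof.
elim: s => [|a s IH]; first by [].
case: s IH => [|b s] IH; first by rewrite /= !andbT.
case: s IH => [|c s] IH.
  change (e a b x && tpath ([:: b] ++ x :: y :: t) =
          e a b x && tpath ([:: b] ++ [:: x; y]) && tpath (x :: y :: t)).
  by rewrite IH andbA.
change (e a b c && tpath ([:: b, c & s] ++ x :: y :: t) =
        e a b c && tpath ([:: b, c & s] ++ [:: x; y]) && tpath (x :: y :: t)).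
by rewrite IH andbA.
Qed.

Lemma tpath_rev : (forall x y z, e x y z = e z y x) -> forall s, tpath (rev s) = tpath s.
Proof.
move=> esym; elim => [|x s IH]; first by [].
case: s IH => [|y s] IH; first by [].
case: s IH => [|z s] IH; first by [].
rewrite !rev_cons -!cats1 -!catA /= tpath_glue /= andbT.
have -> : rev s ++ [:: z; y] = rev (y :: z :: s).
  by rewrite !rev_cons -!cats1 -!catA.
by rewrite IH esym andbC.
Qed.

Lemma tpath_cat_r s t : tpath (s ++ t) -> tpath t.
Proof.
elim: s => [|a s IH] //= H; apply: IH; move: H.
by case: (s ++ t) => [|b [|c u]] //= /andP[].
Qed.

Definition same_ends (s s' : seq V) :=
  (take 2 s' == take 2 s) && (take 2 (rev s') == take 2 (rev s)).

Lemma take2P (s : seq V) : 1 < size s -> exists x y t, s = x :: y :: t.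
Proof. by case: s => [|x [|y t]] // _; exists x, y, t. Qed.

Lemma take2_revP (s : seq V) : 1 < size s -> exists x y t, s = t ++ [:: x; y].
Proof.
rewrite -size_rev => /take2P [y [x [t Ht]]]; exists x, y, (rev t).
by rewrite -[s]revK Ht !rev_cons -!cats1 -catA.
Qed.

Lemma take2_rev_cat (s : seq V) x y : take 2 (rev (s ++ [:: x; y])) = [:: y; x].
Proof. by rewrite rev_cat /= take0. Qed.

(* Only the two boundary pairs of [s] interact with its surroundings. *)
Lemma tpath_swap pre s s' post : 1 < size s -> 1 < size s' -> same_ends s s' ->
  tpath (pre ++ s ++ post) -> tpath s' -> tpath (pre ++ s' ++ post).
Proof.
move=> hs hs' /andP[/eqP h1 /eqP h2] H H'.
have [x [y [t Et]]] := take2P hs.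
have [x' [y' [t' Et']]] := take2P hs'.
have [z [w [r Er]]] := take2_revP hs.
have [z' [w' [r' Er']]] := take2_revP hs'.
move: h1; rewrite Et Et' /= !take0 => -[Ex Ey]; subst x' y'.
move: h2; rewrite Er Er' !take2_rev_cat => -[Ew Ez]; subst z' w'.
have Hpre : tpath (pre ++ [:: x; y]).
  by move: H; rewrite Et /= tpath_glue => /andP[].
have Hpost : tpath (z :: w :: post).
  by move: H; rewrite Er -!catA catA /= tpath_glue => /andP[].
have : tpath (s' ++ post) by rewrite Er' -catA /= tpath_glue -Er' H' Hpost.
by rewrite Et' /= tpath_glue Hpre.
Qed.

End TightPaths.

(** * Words and their densities *)

Section Counting.
Variable V : finType.
Implicit Types (P Q : pred (seq V)) (s t : seq V).

(** Words are lists rather than tuples, so that concatenating and reordering them needs no casts. *)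
Definition words m : seq (seq V) := [seq val t | t : m.-tuple V].

Lemma mem_words m s : (s \in words m) = (size s == m).
Proof.
apply/mapP/eqP => [[t _ ->]|H]; first by rewrite size_tuple.
by exists (tcast H (in_tuple s)); rewrite ?mem_enum //= val_tcast.
Qed.

Lemma uniq_words m : uniq (words m).
Proof. by rewrite map_inj_uniq ?enum_uniq //; exact: val_inj. Qed.

Lemma size_words m : size (words m) = #|V| ^ m.
Proof. by rewrite size_map -cardE card_tuple. Qed.

Definition cnt m P := count P (words m).

(** [C] is the inverse of a density, which keeps all counting in the natural numbers. *)
Definition dense m C P := #|V| ^ m <= C * cnt m P.

Lemma perm_words_cat m k :
  perm_eq (words (m + k)) [seq s ++ t | s <- words m, t <- words k].
Proof.
apply: uniq_perm; first exact: uniq_words.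
  apply: allpairs_uniq; rewrite ?uniq_words // => -[s t] [s' t'].
  move=> /allpairsP [[a b] [/= ha _ [-> ->]]] /allpairsP [[a' b'] [/= ha' _ [-> ->]]].
  move: ha ha'; rewrite !mem_words => /eqP ha /eqP ha' /= /eqP.
  by rewrite eqseq_cat ?ha ?ha' // => /andP[/eqP-> /eqP->].
move=> s; rewrite mem_words; apply/eqP/allpairsP => [H|[[a b] [/= + + ->]]].
  exists (take m s, drop m s); rewrite !mem_words size_drop size_takel ?H ?leq_addr //.
  by rewrite /= cat_take_drop addKn !eqxx.
by rewrite !mem_words size_cat => /eqP-> /eqP->.
Qed.

Lemma count_sum (T : Type) (p : pred T) (s : seq T) :
  count p s = \sum_(x <- s) p x.
Proof. by rewrite -sum1_count big_mkcond. Qed.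

Lemma cnt_cat m k P : cnt (m + k) P = \sum_(s <- words m) cnt k (fun t => P (s ++ t)).
Proof.
rewrite /cnt (permP (perm_words_cat m k)) count_sum.
rewrite big_allpairs_dep /=; apply: eq_bigr => s _; by rewrite count_sum.
Qed.

Lemma cnt_le m P Q : (forall s, size s = m -> P s -> Q s) -> cnt m P <= cnt m Q.
Proof.
move=> H; rewrite /cnt !count_sum; rewrite big_seq [X in _ <= X]big_seq.
apply: leq_sum => s; rewrite mem_words => /eqP hs.
by have := H s hs; case: (P s) => // ->.
Qed.

(** Product rule: the words are chosen in two stages, and the second choice may depend on the
    first. *)
Lemma dense_cat m k C D P (Q : seq V -> pred (seq V)) (S : pred (seq V)) :
  dense m C P ->
  (forall s, size s = m -> P s -> dense k D (Q s)) ->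
  (forall s t, size s = m -> size t = k -> P s -> Q s t -> S (s ++ t)) ->
  dense (m + k) (C * D) S.
Proof.
rewrite /dense => HP HQ HS.
rewrite cnt_cat expnD.
apply: (@leq_trans (C * cnt m P * #|V| ^ k)); first by rewrite leq_mul2r HP orbT.
rewrite -!mulnA leq_mul2l /cnt count_sum; apply/orP; right.
rewrite big_distrl big_distrr /= big_seq [X in _ <= X]big_seq.
apply: leq_sum => s; rewrite mem_words => /eqP hs.
have := HQ s hs; have := HS s; case: (P s); rewrite ?mul0n // => hS hQ.
rewrite mul1n; apply: leq_trans (hQ isT) _; rewrite leq_mul2l.
apply/orP; right; apply: cnt_le => t ht; exact: hS.
Qed.

Lemma dense_rcons m C D P (q : seq V -> pred V) (S : pred (seq V)) :
  dense m C P ->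
  (forall s, size s = m -> P s -> #|V| <= D * #|[set x | q s x]|) ->
  (forall s x, size s = m -> P s -> q s x -> S (rcons s x)) ->
  dense m.+1 (C * D) S.
Proof.
move=> HP HQ HS; rewrite -addn1.
apply: (dense_cat (Q := fun s t => if t is [:: x] then q s x else false) HP).
  move=> s hs Ps; rewrite /dense expn1; apply: leq_trans (HQ s hs Ps) _.
  rewrite leq_mul2l; apply/orP; right.
  rewrite /cnt -size_filter cardE -(size_map (fun x => [:: x])).
  apply: uniq_leq_size; first by rewrite map_inj_uniq ?enum_uniq // => x y [].
  move=> _ /mapP[x + ->]; by rewrite mem_enum inE mem_filter mem_words => ->.
by move=> s [|x [|]] // hs _ Ps qs; rewrite cats1; apply: HS.
Qed.

(** Serves to permute the positions of a word: letters are chosen, and doubled, only at its end,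
    which is rarely their order along the path. *)
Lemma dense_inj_in m C P Q (f g : seq V -> seq V) :
  dense m C P ->
  (forall s, size s = m -> g (f s) = s) ->
  (forall s, size s = m -> size (f s) = m) ->
  (forall s, size s = m -> P s -> Q (f s)) ->
  dense m C Q.
Proof.
rewrite /dense => HP fi fs fP; apply: leq_trans HP _; rewrite leq_mul2l; apply/orP; right.
rewrite /cnt -!size_filter -(size_map f); apply: uniq_leq_size.
  rewrite map_inj_in_uniq ?filter_uniq ?uniq_words // => s t.
  rewrite !mem_filter !mem_words => /andP[_ /eqP hs] /andP[_ /eqP ht] E.
  by rewrite -(fi _ hs) E fi.
move=> _ /mapP[s + ->]; rewrite !mem_filter !mem_words => /andP[Ps /eqP hs].
by rewrite fP // fs // eqxx.
Qed.

Lemma dense_le m C P Q : (forall s, size s = m -> P s -> Q s) -> dense m C P -> dense m C Q.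
Proof. by move=> H /leq_trans; apply; rewrite leq_mul2l cnt_le ?orbT. Qed.

(** Cauchy-Schwarz against the constant 1; in the induction each cross term [2 * (F x * F y)] is at
    most [F x ^ 2 + F y ^ 2]. *)
Lemma sum_sqr (T : Type) (r : seq T) (F : T -> nat) :
  (\sum_(i <- r) F i) ^ 2 <= size r * \sum_(i <- r) F i ^ 2.
Proof.
elim: r => [|x r IH]; first by rewrite !big_nil.
rewrite !big_cons /=.
set A := \sum_(i <- r) F i in IH *; set B := \sum_(i <- r) F i ^ 2 in IH *.
have H : 2 * (F x * A) <= size r * F x ^ 2 + B.
  rewrite /A /B; elim: (r) => [|y r' IH']; first by rewrite !big_nil muln0.
  rewrite !big_cons /=.
  have := (nat_Cauchy (F x) (F y)).1; move: IH'; clear.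
  move: (\sum_(i <- r') _) (\sum_(i <- r') _) (F x) (F y) (size r') => a b c d s; nia.
by move: IH H; clear; nia.
Qed.

(* Cauchy-Schwarz over the common stem [s]. *)
Lemma dense_double m k C P Q :
  dense (m + k) C P ->
  (forall s t t', size s = m -> size t = k -> size t' = k ->
     P (s ++ t) -> P (s ++ t') -> Q (s ++ t ++ t')) ->
  dense (m + (k + k)) (C ^ 2) Q.
Proof.
rewrite /dense cnt_cat => HP HQ.
set F := fun s => cnt k (fun t => P (s ++ t)) in HP.
have HF : \sum_(s <- words m) F s ^ 2 <= cnt (m + (k + k)) Q.
  rewrite cnt_cat big_seq [X in _ <= X]big_seq; apply: leq_sum => s.
  rewrite mem_words => /eqP hs; rewrite cnt_cat.
  rewrite -mulnn {1}/F /cnt count_sum big_distrl /= big_seq [X in _ <= X]big_seq.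
  apply: leq_sum => t; rewrite mem_words => /eqP ht.
  case E : (P (s ++ t)); rewrite ?mul0n // mul1n; apply: cnt_le => t' ht' E'.
  exact: HQ.
have CS := sum_sqr (words m) F.
move: CS HF HP; rewrite size_words.
set S := \sum_(i <- _) F i; set S2 := \sum_(i <- _) F i ^ 2 => CS HF HP.
case: (posnP (#|V| ^ m)) => [Z|N0]; first by rewrite expnD Z mul0n.
rewrite -(leq_pmul2l N0).
have -> : #|V| ^ m * #|V| ^ (m + (k + k)) = (#|V| ^ (m + k)) ^ 2.
  by rewrite -mulnn -!expnD; congr (_ ^ _); lia.
apply: (@leq_trans ((C * S) ^ 2)); first by rewrite leq_sqr.
rewrite expnMn mulnCA leq_mul2l; apply/orP; right.
by apply: leq_trans CS _; rewrite leq_mul2l HF orbT.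
Qed.

End Counting.

(** * Selecting disjoint words *)

(** Bernoulli's inequality for [(1 + 1/a) ^ n], cleared of denominators. *)
Lemma expn_Bernoulli a n : a ^ n * (a + n) <= a * a.+1 ^ n.
Proof.
elim: n => [|n IH]; first by rewrite !expn0 muln1 mul1n addn0.
by rewrite !expnS; move: IH; move: (a ^ n) (a.+1 ^ n) => x y; nia.
Qed.

Lemma double_expn_pred a : 0 < a -> 2 * a ^ a.+1 <= a.+1 ^ a.+1.
Proof.
move=> a0; rewrite -(leq_pmul2l a0); apply: leq_trans (expn_Bernoulli a a.+1).
by rewrite mulnCA mulnA mulnC leq_mul2l; apply/orP; right; lia.
Qed.

Lemma sum_const_seq (T : Type) (r : seq T) c : \sum_(i <- r) c = c * size r.
Proof. by rewrite big_const_seq count_predT iter_addn_0. Qed.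

Lemma size_flatten_const (T : Type) m (L : seq (seq T)) :
  all (fun s => size s == m) L -> size (flatten L) = m * size L.
Proof.
elim: L => [|s L IH] /=; first by rewrite muln0.
by move=> /andP[/eqP hs /IH HL]; rewrite size_cat hs HL mulnS.
Qed.

Lemma count_flatten_sum (T : Type) (p : pred T) (L : seq (seq T)) :
  count p (flatten L) = \sum_(s <- L) count p s.
Proof. by elim: L => [|s L IH]; rewrite ?big_nil ?big_cons //= count_cat IH. Qed.

Section Selection.
Variable V : finType.
Implicit Types (P Q : pred (seq V)) (s t F : seq V).

Definition fresh F : pred (seq V) := fun s => uniq (s ++ F).

(** Union bound over the letters: a fresh prefix becomes stale only through one of its own letters
    or one of [F]. *)
Lemma cnt_stale m F : uniq F ->
  cnt m (fun s => ~~ fresh F s) * #|V| <= m * (m + size F) * #|V| ^ m.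
Proof.
move=> uF; elim: m => [|m IH].
  rewrite /cnt count_sum big_seq big1 // => s; rewrite mem_words => /nilP ->.
  by rewrite /fresh /= uF.
have H : cnt m.+1 (fun s => ~~ fresh F s) <=
    cnt m (fun s => ~~ fresh F s) * #|V| + #|V| ^ m * (m + size F).
  rewrite -addn1 cnt_cat.
  have -> : cnt m (fun s => ~~ fresh F s) * #|V| + #|V| ^ m * (m + size F) =
    \sum_(s <- words V m) ((~~ fresh F s) * #|V| + (m + size F)).
    by rewrite big_split /= -big_distrl -count_sum sum_const_seq size_words [(m + size F) * _]mulnC.
  rewrite big_seq [leqRHS]big_seq; apply: leq_sum => s; rewrite mem_words => /eqP hs.
  case Fs : (fresh F s) => /=; last first.
    rewrite mul1n; apply: leq_trans (leq_addr _ _).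
    by rewrite /cnt; apply: leq_trans (count_size _ _) _; rewrite size_words expn1.
  rewrite mul0n add0n -hs -size_cat /cnt -size_filter -(size_map (fun x => [:: x]) (s ++ F)).
  apply: uniq_leq_size; first by rewrite filter_uniq // uniq_words.
  move=> t; rewrite mem_filter mem_words => /andP[+ /eqP ht].
  case: t ht => [|x [|]] // _.
  rewrite /fresh -catA uniq_catCA /= negb_and => /orP[|].
    by rewrite negbK => ?; apply/mapP; exists x.
  by move: Fs; rewrite /fresh => ->.
have H2 : #|V| * cnt m.+1 (fun s => ~~ fresh F s) <= 
   #|V| * (m * (m + size F) * #|V| ^ m + #|V| ^ m * (m + size F)).
  rewrite leq_mul2l; apply/orP; right; apply: leq_trans H _; by rewrite leq_add2r.
rewrite mulnC; apply: leq_trans H2 _; rewrite expnS.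
by move: (#|V| ^ m) => a; nia.
Qed.

(** The size condition makes stale words at most a fraction [1/(2C)] of all, so half of the
    guaranteed [1/C] survives. *)
Lemma dense_fresh m C P F : 0 < #|V| -> uniq F -> dense m C P ->
  2 * C * (m * (m + size F)) <= #|V| ->
  dense m (2 * C) (fun s => P s && fresh F s).
Proof.
move=> V0 uF; rewrite /dense => HP Hn; have Hb := cnt_stale m uF.
have Hp : cnt m P <= cnt m (fun s => P s && fresh F s) + cnt m (fun s => ~~ fresh F s).
  rewrite /cnt !count_sum -big_split /=.
  by apply: leq_sum => s _; case: (P s); case: (fresh F s).
set p := cnt m P in HP Hp; set g := cnt m _ in Hp *; set b := cnt m _ in Hb Hp.
set a := #|V| ^ m in HP Hb *; set q := m * _ in Hb Hn.
have : #|V| * (2 * C * b) <= #|V| * a.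
  apply: (@leq_trans (2 * C * (q * a))).
    by rewrite [leqLHS]mulnC -mulnA leq_mul2l Hb orbT.
  by rewrite mulnA leq_mul2r Hn orbT.
rewrite leq_pmul2l // => Hb2; have := leq_mul (leqnn (2 * C)) Hp; move: HP Hb2.
by clear; nia.
Qed.

Variable I : finType.
Implicit Types (w : I -> nat).

(** Double counting of pairs of an index and a fresh word serving it: some word serves at least the
    average weight. *)
Lemma popular_word m C (A : I -> pred (seq V)) w F : 0 < #|V| -> uniq F ->
  (forall i, dense m C (A i)) -> 2 * C * (m * (m + size F)) <= #|V| ->
  0 < \sum_i w i ->
  exists s, [/\ size s = m, fresh F s &
    \sum_i w i <= 2 * C * \sum_(i | A i s) w i].
Proof.
move=> V0 uF HA Hn W0.
pose g s := \sum_i w i * (A i s && fresh F s).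
have Hg : (\sum_i w i) * #|V| ^ m <= 2 * C * \sum_(s <- words V m) g s.
  rewrite /g exchange_big /= big_distrl big_distrr /=; apply: leq_sum => i _.
  rewrite -big_distrr /= -count_sum mulnCA leq_mul2l; apply/orP; right.
  exact: dense_fresh (HA i) Hn.
have [/hasP [s ]|/hasPn H] := boolP (has (fun s => \sum_i w i <= 2 * C * g s) (words V m)).
  rewrite mem_words => /eqP hs Hs; exists s.
  have Fs : fresh F s.
    apply/negPn/negP => /negbTE E; move: Hs.
    have -> : g s = 0 by apply: big1 => i _; rewrite E andbF muln0.
    by rewrite muln0 leqNgt W0.
  split => //; apply: leq_trans Hs _; rewrite leq_mul2l; apply/orP; right.
  by rewrite [leqRHS]big_mkcond; apply: leq_sum => i _; rewrite Fs andbT; case: (A i s);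
     rewrite ?muln1 ?muln0.
exfalso; move: Hg; rewrite leqNgt => /negP; apply.
rewrite big_distrr /=.
have -> : (\sum_i w i) * #|V| ^ m = \sum_(s <- words V m) \sum_i w i.
  by rewrite sum_const_seq size_words.
have : words V m != [::] by rewrite -size_eq0 size_words -lt0n expn_gt0 V0.
elim: (words V m) H => [|s r IH] // H _; rewrite !big_cons -addSn; apply: leq_add.
  by rewrite ltnNge; apply: H; rewrite inE eqxx.
case: r IH H => [|s' r] IH H; first by rewrite !big_nil.
by apply: ltnW; apply: IH => // t ht; apply: H; rewrite inE ht orbT.
Qed.

(* The weight [2 ^ (k - count)] of an index halves relative to the others
   each time a chosen word serves it. *)
Lemma greedy_words m C (A : I -> pred (seq V)) F k : 0 < #|V| -> 0 < C -> uniq F ->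
  (forall i, dense m C (A i)) -> 2 * C * (m * (m + size F + m * k)) <= #|V| ->
  exists L : seq (seq V), [/\ size L = k, all (fun s => size s == m) L,
    uniq (flatten L ++ F) &
    (4 * C) ^ k * \sum_i 2 ^ (k - count (A i) L) <= (2 * (4 * C).-1) ^ k * #|I| ].
Proof.
move=> V0 C0 uF HA; elim: k => [|k IH] Hn.
  exists [::]; split=> //=; rewrite !mul1n.
  by rewrite sum_nat_const muln1.
have [|L [sL aL uL HL]] := IH.
  by apply: leq_trans Hn; rewrite !leq_mul2l leq_add2l leq_mul2l leqnSn !orbT.
(* Without indices the total weight is 0 and gives no average to exceed; any fresh word will do. *)
have [I0|I0] := posnP #|I|.
  have I0' : forall G : I -> nat, \sum_i G i = 0.
    by move=> G; apply: big1 => i _; have := max_card (pred1 i); rewrite card1 I0.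
  have szL : size (flatten L) = m * k by rewrite (size_flatten_const aL) sL.
  have := @dense_fresh m C predT (flatten L ++ F) V0 uL.
  have bT : dense m C (@predT (seq V)).
    by rewrite /dense /cnt count_predT size_words leq_pmull.
  move=> /(_ bT); rewrite size_cat szL => H.
  have : 2 * C * (m * (m + (m * k + size F))) <= #|V|.
    by apply: leq_trans Hn; rewrite !leq_mul2l; apply/orP; right; apply/orP; right; lia.
  move/H; rewrite /dense => H'.
  have : 0 < cnt m (fun s => predT s && fresh (flatten L ++ F) s).
    have : 0 < #|V| ^ m by rewrite expn_gt0 V0.
    by case: (cnt m _) H' => // ; rewrite muln0; case: (#|V| ^ m).
  rewrite /cnt -has_count => /hasP[s]; rewrite mem_words => hs /= Fs.
  by exists (s :: L); rewrite /= sL hs aL -catA I0' muln0.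
have [||s [hs Fs Hs]] := @popular_word m C A (fun i => 2 ^ (k - count (A i) L))
   (flatten L ++ F) V0 uL HA.
- have szL : size (flatten L) = m * k by rewrite (size_flatten_const aL) sL.
  rewrite size_cat szL; apply: leq_trans Hn; rewrite !leq_mul2l.
  by apply/orP; right; apply/orP; right; lia.
- move/card_gt0P: I0 => [i _]; rewrite (bigD1 i) //= ltn_addr // expn_gt0.
  by [].
exists (s :: L); split; rewrite /= ?sL ?hs ?eqxx ?aL //.
  by rewrite -catA.
set W := \sum_i 2 ^ (k - count (A i) L) in HL Hs.
set U := \sum_(i | A i s) _ in Hs.
(* Raising [k] doubles every weight, and the indices served by [s] are halved back. As [U] is at
   least [W/(2C)], the new sum is at most [2 (1 - 1/(4C)) W]. *)
have E : \sum_i 2 ^ (k.+1 - (A i s + count (A i) L)) + U = 2 * W.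
  rewrite /U [X in _ + X]big_mkcond -big_split /= /W big_distrr /=.
  apply: eq_bigr => i _; have cL : count (A i) L <= k by rewrite -sL count_size.
  case: (A i s) => /=; first by rewrite add1n subSS addnn mul2n.
  by rewrite add0n subSn // expnS addn0.
have {E Hs}: (4 * C) * \sum_i 2 ^ (k.+1 - (A i s + count (A i) L)) <= 2 * (4 * C).-1 * W.
  by move: E Hs C0; clear; case: C => [|C] //; nia.
move: (\sum_i _) => Z HZ.
rewrite !expnS; apply: (@leq_trans ((4 * C) ^ k * (2 * (4 * C).-1 * W))).
  by rewrite -mulnA mulnCA leq_mul2l HZ orbT.
by rewrite mulnCA -[leqRHS]mulnA leq_mul2l HL orbT.
Qed.

(** A single weight is at most the sum of all. With [D = 4C] and [k = 2qD] words, [(1 - 1/D) ^ k] is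
    at most [2 ^ -2q]; this beats the factor [#|I| <= 2 ^ q] and leaves [2 ^ -count <= 2 ^ -q]. *)
Lemma selection m C (A : I -> pred (seq V)) F q : 0 < #|V| -> 0 < C -> uniq F ->
  (forall i, dense m C (A i)) -> #|I| <= 2 ^ q ->
  2 * C * (m * (m + size F + m * (8 * C * q))) <= #|V| ->
  exists L : seq (seq V), [/\ size L = 8 * C * q, all (fun s => size s == m) L,
    uniq (flatten L ++ F) & forall i, q <= count (A i) L].
Proof.
move=> V0 C0 uF HA HI Hn; have [L [sL aL uL HL]] := greedy_words V0 C0 uF HA Hn.
exists L; split => // i; move: HL; set k := 8 * C * q; set D := 4 * C => HL.
have D1 : 0 < D.-1 by rewrite /D; lia.
have cL : count (A i) L <= k by rewrite /k -sL count_size.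
have H1 : 2 ^ (k - count (A i) L) * 2 ^ count (A i) L = 2 ^ k by rewrite -expnD subnK.
have H2 : D ^ k * 2 ^ (k - count (A i) L) <= (2 * D.-1) ^ k * #|I|.
  apply: leq_trans HL; rewrite leq_mul2l; apply/orP; right.
  by rewrite (bigD1 i) //= leq_addr.
have H3 : D ^ k <= D.-1 ^ k * (2 ^ q * 2 ^ count (A i) L).
  have H : D ^ k * 2 ^ k <= D.-1 ^ k * (2 ^ q * 2 ^ count (A i) L) * 2 ^ k.
    rewrite -H1 {1}mulnA; apply: (@leq_trans ((2 * D.-1) ^ k * #|I| * 2 ^ count (A i) L)).
      by rewrite leq_mul2r H2 orbT.
    rewrite H1 expnMn.
    have := leq_mul (leqnn (2 ^ k * D.-1 ^ k * 2 ^ count (A i) L)) HI; clear; nia.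
  by move: H; rewrite leq_pmul2r // expn_gt0.
have H4 : 2 ^ (2 * q) * D.-1 ^ k <= D ^ k.
  have -> : k = D * (2 * q) by rewrite /k /D; lia.
  case: (posnP q) => [->|q0]; first by rewrite !muln0.
  rewrite !(expnM _ D) -expnMn leq_exp2r ?muln_gt0 //.
  by have := double_expn_pred D1; rewrite prednK // /D; lia.
have := leq_trans H4 H3; rewrite mulnC leq_pmul2l ?expn_gt0 ?D1 //.
rewrite -expnD leq_exp2l //; lia.
Qed.

End Selection.

(** * Connecting and absorbing *)

Section PosaGraph.
Variables (n : nat) (E : {set {set 'I_n}}) (K f : nat).
Hypotheses (E3 : is_3graph E) (f0 : 0 < f) (nK : n <= K * f).
Hypothesis degE : forall x y : 'I_n, x != y ->
  minn (minn x y) n./2 + 8 * f <= pair_deg E x y.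

Definition edge (x y z : 'I_n) := [set x; y; z] \in E.

Lemma edge_rot x y z : edge x y z = edge y z x.
Proof.
rewrite /edge; congr (_ \in E); apply/setP => w; rewrite !inE.
by case: (w == x); case: (w == y); case: (w == z).
Qed.

Lemma edge_swap x y z : edge x y z = edge y x z.
Proof. by rewrite /edge [[set x; y]]setUC. Qed.

Lemma edge_rev x y z : edge x y z = edge z y x.
Proof. by rewrite edge_rot edge_swap. Qed.

Lemma edge_swap23 x y z : edge x y z = edge x z y.
Proof. by rewrite (edge_rot x y) (edge_rot y z) (edge_swap z x). Qed.

Lemma edge_neq12 x y z : edge x y z -> x != y.
Proof.
move=> /E3; apply: contra_eqN => /eqP ->; rewrite setUid cards2; by case: (y == z).
Qed.

Lemma edge_neq23 x y z : edge x y z -> y != z.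
Proof. by rewrite edge_rot => /edge_neq12. Qed.

Lemma edge_neq13 x y z : edge x y z -> x != z.
Proof. by rewrite edge_swap => /edge_neq23. Qed.

Lemma pair_degE x y : pair_deg E x y = #|[set z | edge x y z]|.
Proof. by []. Qed.

(* Level [j] collects the vertices that [j] steps of gaining [f] must reach;
   level [K] is the upper half. *)
Definition lev j (x : 'I_n) := minn n./2 (j * f) <= x.

Lemma lev0 x : lev 0 x. Proof. by rewrite /lev mul0n minn0. Qed.

Lemma levW i j x : i <= j -> lev j x -> lev i x.
Proof.
by rewrite /lev => ij; have : i * f <= j * f by [rewrite leq_mul2r ij orbT]; lia.
Qed.

Lemma lev_half j x : K <= j -> lev j x = (n./2 <= x).
Proof.
move=> Kj; rewrite /lev; have : K * f <= j * f by rewrite leq_mul2r Kj orbT.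
by move=> H; rewrite (minn_idPl _) //; lia.
Qed.

Lemma card_low m : #|[set z : 'I_n | z < m]| <= m.
Proof.
rewrite cardE -(size_map val) -[leqRHS](size_iota 0).
apply: uniq_leq_size; first by rewrite map_inj_uniq ?enum_uniq //; exact: val_inj.
by move=> _ /mapP[z + ->]; rewrite mem_enum inE mem_iota.
Qed.

(** The pair degree is at least [min(n/2, j f) + 8 f], while at most [min(n/2, (j+1) f)] vertices
    miss level [j+1]. Even without [v] at least [f] remain, and [f] is at least [n/K]. *)
Lemma nbr_lev j x y : x != y -> lev j x -> lev j y ->
  forall v, n <= K * #|[set z | [&& edge x y z, lev j.+1 z & z != v]]|.
Proof.
move=> xy lx ly v; apply: leq_trans nK _; rewrite leq_mul2l; apply/orP; right.
have := degE xy; rewrite pair_degE.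
have := card_low (minn n./2 (j.+1 * f)).
have : #|[set z | edge x y z]| <= #|[set z | [&& edge x y z, lev j.+1 z & z != v]]| +
   (#|[set z : 'I_n | z < minn n./2 (j.+1 * f)]| + #|[set v]|).
  apply: leq_trans (leq_add (leqnn _) (leq_card_setU _ _)).
  apply: leq_trans (leq_card_setU _ _); apply: subset_leq_card; apply/subsetP => z.
  by rewrite !inE => ->; rewrite ltnNge /lev; case: (_ <= z); case: (z == v).
rewrite cards1; move: lx ly; rewrite /lev; nia.
Qed.

(** Inclusion-exclusion: in the upper half both pair degrees are at least [n./2 + 8 f]. *)
Lemma common_nbr j x y z w : K <= j -> lev j x -> lev j y -> lev j z -> lev j w ->
  x != y -> z != w -> n <= K * #|[set v | edge x y v && edge z w v]|.
Proof.
move=> Kj; rewrite !lev_half // => hx hy hz hw xy zw.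
apply: leq_trans nK _; rewrite leq_mul2l; apply/orP; right.
have := degE xy; have := degE zw; rewrite !pair_degE.
have := cardsUI [set v | edge x y v] [set v | edge z w v].
have : #|[set v | edge x y v] :|: [set v | edge z w v]| <= n.
  by rewrite -[leqRHS]card_ord max_card.
have -> : [set v | edge x y v] :&: [set v | edge z w v] = [set v | edge x y v && edge z w v].
  by apply/setP => v; rewrite !inE.
lia.
Qed.

Lemma nbr_lev_top j x y v : K <= j -> x != y -> lev j x -> lev j y ->
  n <= K * #|[set z | [&& edge x y z, lev j z & z != v]]|.
Proof.
move=> Kj xy lx ly; apply: leq_trans (nbr_lev xy lx ly v) _.
rewrite leq_mul2l; apply/orP; right; apply: subset_leq_card; apply/subsetP => z.
by rewrite !inE !lev_half // leqW.
Qed.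

Notation tp := (tpath edge).

Lemma dense_nil : dense 0 1 (fun s : seq 'I_n => s == [::]).
Proof. by rewrite /dense expn0 mul1n /cnt -has_count; apply/hasP; exists [::]; rewrite ?mem_words. Qed.

(* The path is [a b p u w p' u' m p'' c d]: [u, u'] are two copies of one vertex
   with common stem [p, p', w], and [p', p''] are two copies of one vertex. *)
Lemma connect_high a b c d : a != b -> c != d ->
  lev K a -> lev K b -> lev K c -> lev K d ->
  dense 7 (K ^ 18) (fun s => tp (a :: b :: s ++ [:: c; d])).
Proof.
move=> ab cd la lb lc ld; set L := lev K in la lb lc ld.
have cN k (q : pred 'I_n) : n <= k * #|[set x | q x]| -> #|'I_n| <= k * #|[set x | q x]|.
  by rewrite card_ord.
pose P1 s := if s is [:: p] then edge a b p && L p else false.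
pose P2 s := if s is [:: p; p'] then [&& edge a b p, L p, edge c d p' & L p'] else false.
pose P3 s := if s is [:: p; p'; u] then
  [&& edge a b p, L p, edge c d p', L p', edge b p u, L u & u != p'] else false.
pose P4 s := if s is [:: p; p'; u; w] then
  [&& edge a b p, edge c d p', L p', edge b p u, L u, edge p u w & edge u p' w] else false.
pose P4' s := if s is [:: p; p'; w; u] then
  [&& edge a b p, edge c d p', L p', edge b p u, L u, edge p u w & edge u p' w] else false.
pose P5 s := if s is [:: p; p'; w; u; u'] then
  [&& edge a b p, edge c d p', L p', edge b p u, edge p u w, edge u p' w, L u' & edge u' p' w] else false.
pose P6 s := if s is [:: p; p'; w; u; u'; m] then
  [&& edge a b p, edge c d p', edge b p u, edge p u w, edge u p' w, edge u' p' w,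
    edge u' p' m & edge c p' m] else false.
pose P6' s := if s is [:: p; w; u; u'; m; p'] then
  [&& edge a b p, edge c d p', edge b p u, edge p u w, edge u p' w, edge u' p' w,
    edge u' p' m & edge c p' m] else false.
pose P7 s := if s is [:: p; w; u; u'; m; p'; p''] then
  tp (a :: b :: [:: p; u; w; p'; u'; m; p''] ++ [:: c; d]) else false.
have B1 : dense 1 K P1.
  rewrite -[K]mul1n; apply: (dense_rcons (q := fun _ p => [&& edge a b p, L p & p != a]) dense_nil).
    by move=> s _ _; apply/cN/nbr_lev_top.
  by move=> [|//] x _ _ /and3P[h1 h2 _] /=; rewrite h1.
have B2 : dense 2 (K * K) P2.
  apply: (dense_rcons (q := fun _ p => [&& edge c d p, L p & p != a]) B1).
    by move=> s _ _; apply/cN/nbr_lev_top.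
  by move=> [|p [|]] //= x _ /andP[-> ->] /and3P[-> -> _].
have B3 : dense 3 (K * K * K) P3.
  apply: (dense_rcons (q := fun s u => if s is [:: p; p'] then
       [&& edge b p u, L u & u != p'] else false) B2).
    move=> [|p [|p' []]] //= _ /and4P[h lp h' lp'].
    by apply/cN/nbr_lev_top => //; apply: edge_neq23 h.
  by move=> [|p [|p' []]] //= x _ /and4P[-> -> -> ->] /and3P[-> -> ->].
have B4 : dense 4 (K * K * K * K) P4.
  apply: (dense_rcons (q := fun s w => if s is [:: p; p'; u] then
       edge p u w && edge u p' w else false) B3).
    move=> [|p [|p' [|u []]]] //= _ /and5P[h lp h' lp' /and3P[hu lu up]].
    apply/cN/(common_nbr (j := K)) => //; exact: edge_neq23 hu.
  by move=> [|p [|p' [|u []]]] //= x _ /and5P[-> _ -> -> /and3P[-> -> _]] /andP[-> ->].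
(* The vertex to be doubled is moved to the end; the same is done for [p'] below. *)
have B4' : dense (3 + 1) (K * K * K * K) P4'.
  pose h (s : seq 'I_n) := if s is [:: p; p'; u; w] then [:: p; p'; w; u] else s.
  apply: (dense_inj_in (f := h) (g := h) B4) => -[|p [|p' [|u [|w []]]]] //=.
have B5 : dense (3 + (1 + 1)) ((K * K * K * K) ^ 2) P5.
  apply: (dense_double B4') => -[|p [|p' [|w []]]] // [|u []] // [|u' []] //= _ _ _.
  by move=> /and5P[-> -> -> -> /and3P[_ -> ->]] /and5P[_ _ _ _ /and3P[-> _ ->]].
have B6 : dense 6 ((K * K * K * K) ^ 2 * K) P6.
  apply: (dense_rcons (q := fun s m => if s is [:: p; p'; w; u; u'] then
       edge u' p' m && edge c p' m else false) B5).
    move=> [|p [|p' [|w [|u [|u' []]]]]] //= _ /and5P[h h' lp' _ /and4P[_ _ lu' h3]].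
    apply/cN/(common_nbr (j := K)) => //; first exact: edge_neq12 h3.
    by rewrite eq_sym; move: h'; rewrite edge_rot => /edge_neq23; rewrite eq_sym.
  by move=> [|p [|p' [|w [|u [|u' []]]]]] //= x _ /and5P[-> -> _ -> /and4P[-> -> _ ->]] /andP[-> ->].
have B6' : dense (5 + 1) ((K * K * K * K) ^ 2 * K) P6'.
  pose h (s : seq 'I_n) := if s is [:: p; p'; w; u; u'; m] then [:: p; w; u; u'; m; p'] else s.
  pose g (s : seq 'I_n) := if s is [:: p; w; u; u'; m; p'] then [:: p; p'; w; u; u'; m] else s.
  by apply: (dense_inj_in (f := h) (g := g) B6) => -[|p [|p' [|w [|u [|u' [|m []]]]]]] //=.
have B7 : dense (5 + (1 + 1)) (((K * K * K * K) ^ 2 * K) ^ 2) P7.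
  apply: (dense_double B6') => -[|p [|w [|u [|u' [|m []]]]]] // [|p' []] // [|p'' []] //= _ _ _.
  move=> /and5P[-> h2 -> -> /and4P[h5 h6 h7 h8]] /and5P[_ h2' _ _ /and4P[h5' h6' h7' h8']].
  rewrite (edge_swap23 u w) h5 (edge_rev w) h6 (edge_swap p') h7 (edge_swap23 u' m) h7'.
  by rewrite (edge_rev m) h8' (edge_rot p'') h2'.
(* Four choices, a doubling, one more choice and a second doubling: [(4 * 2 + 1) * 2 = 18]. *)
have -> : K ^ 18 = ((K * K * K * K) ^ 2 * K) ^ 2 by ring.
pose h (s : seq 'I_n) := if s is [:: p; w; u; u'; m; p'; p''] then [:: p; u; w; p'; u'; m; p''] else s.
pose g (s : seq 'I_n) := if s is [:: p; u; w; p'; u'; m; p''] then [:: p; w; u; u'; m; p'; p''] else s.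
by apply: (dense_inj_in (f := h) (g := g) B7) => -[|p [|w [|u [|u' [|m [|p' [|p'' []]]]]]]].
Qed.

Definition top_ends j (s : seq 'I_n) := all (lev j) (take 2 (rev s)).

(** Two steps replace both vertices of the last pair by vertices one level higher. *)
Lemma climb i j x y : x != y -> lev i x -> lev i y ->
  dense (2 * j) (K ^ (2 * j))
    (fun s => tp (x :: y :: s) && top_ends (i + j) (x :: y :: s)).
Proof.
elim: j i x y => [|j IH] i x y xy lx ly.
  rewrite muln0 expn0 addn0; apply: dense_le dense_nil => s _ /eqP ->.
  by rewrite /top_ends /= lx ly.
pose P1 s := if s is [:: z] then edge x y z && lev i.+1 z else false.
pose P2 s := if s is [:: z; w] then
  [&& edge x y z, lev i.+1 z, edge y z w & lev i.+1 w] else false.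
have cN k (q : pred 'I_n) : n <= k * #|[set x | q x]| -> #|'I_n| <= k * #|[set x | q x]|.
  by rewrite card_ord.
have B1 : dense 1 K P1.
  rewrite -[K]mul1n; apply: (dense_rcons (q := fun _ z => [&& edge x y z, lev i.+1 z & z != x]) dense_nil).
    by move=> s _ _; apply/cN/nbr_lev.
  by move=> [|//] z _ _ /and3P[h1 h2 _] /=; rewrite h1.
have B2 : dense 2 (K * K) P2.
  apply: (dense_rcons (q := fun s w => if s is [:: z] then
     [&& edge y z w, lev i.+1 w & w != x] else false) B1).
    move=> [|z []] //= _ /andP[h lz]; apply/cN/nbr_lev => //; last exact: levW lz.
    exact: edge_neq23 h.
  by move=> [|z []] //= w _ /andP[-> ->] /and3P[-> -> _].
have -> : 2 * j.+1 = 2 + 2 * j by lia.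
rewrite expnD -[K ^ 2]mulnn.
apply: (dense_cat (Q := fun s t => tp (s ++ t) && top_ends (i.+1 + j) (s ++ t)) B2).
  move=> [|z [|w []]] //= _ /and4P[_ lz h lw]; apply: IH => //; exact: edge_neq23 h.
move=> [|z [|w []]] //= t _ _ /and4P[-> lz -> lw] /andP[-> ].
rewrite addSnnS /top_ends /= !rev_cons -!cats1 -!catA /=.
by case: (rev t) => [|? [|? ?]] /=; rewrite ?take0.
Qed.

Lemma tpath_last_neq x y s r p q :
  x != y -> tp (x :: y :: s) -> x :: y :: s = r ++ [:: p; q] -> p != q.
Proof.
case: s => [|z s] xy; first by move=> _; case: r => [|? [|? []]] //= [<- <-].
move=> + E1; rewrite E1; case: r E1 => [|r r1] E1; first by case: s E1.
case: (lastP r1) => [|r2 u]; first by rewrite /= andbT; exact: edge_neq23.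
by rewrite -rcons_cons -cats1 -catA => /tpath_cat_r /= /andP[/edge_neq23].
Qed.

(** Climb forwards from [(a, b)] and backwards from [(d, c)], each in [2K] steps to level [K], and
    join the two upper pairs by seven vertices. *)
Lemma connect_pairs a b c d : a != b -> c != d ->
  dense (4 * K + 7) (K ^ (4 * K + 18)) (fun s => tp (a :: b :: s ++ [:: c; d])).
Proof.
move=> ab cd.
have dc : d != c by rewrite eq_sym.
have C1 := climb K ab (lev0 a) (lev0 b).
have C2 := climb K dc (lev0 d) (lev0 c).
have -> : 4 * K + 7 = 2 * K + (2 * K + 7) by lia.
have -> : K ^ (4 * K + 18) = K ^ (2 * K) * (K ^ (2 * K) * K ^ 18).
  by rewrite -!expnD; congr (_ ^ _); lia.
apply: (dense_cat (Q := fun s t => tp (a :: b :: (s ++ t) ++ [:: c; d])) C1) => // s1 hs1.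
move=> /andP[T1]; rewrite add0n /top_ends.
have [//|p [q [r1 E1]]] := @take2_revP _ [:: a, b & s1].
rewrite E1 take2_rev_cat /= andbT => /andP[lq lp].
have pq := tpath_last_neq ab T1 E1.
(* The middle piece depends on both climbs, so it is chosen last; [S] reads the word in the order of
   choice, with the second climb before the middle. *)
pose S t := tp (a :: b :: (s1 ++ drop (2 * K) t ++ rev (take (2 * K) t)) ++ [:: c; d]).
suff B : dense (2 * K + 7) (K ^ (2 * K) * K ^ 18) S.
  pose h (t : seq 'I_n) := drop (2 * K) t ++ rev (take (2 * K) t).
  pose g (t : seq 'I_n) := rev (drop 7 t) ++ take 7 t.
  apply: (dense_inj_in (f := h) (g := g) B) => t ht //.
    rewrite /g /h drop_size_cat ?size_drop ?ht ?addKn // take_size_cat ?size_drop ?ht ?addKn //.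
    by rewrite revK cat_take_drop.
  by rewrite /h size_cat size_rev addnC -size_cat cat_take_drop.
apply: (dense_cat (Q := fun s t => tp (a :: b :: (s1 ++ t ++ rev s) ++ [:: c; d])) C2); last first.
  by move=> s t hs ht _; rewrite /S drop_size_cat // take_size_cat.
move=> s2 hs2 /andP[T2]; rewrite add0n /top_ends.
have [//|p' [q' [r2 E2]]] := @take2_revP _ [:: d, c & s2].
rewrite E2 take2_rev_cat /= andbT => /andP[lq' lp'].
have qp' := tpath_last_neq dc T2 E2; rewrite eq_sym in qp'.
apply: dense_le (connect_high pq qp' lp lq lq' lp') => t _ Ht.
have Er : rev s2 ++ [:: c; d] = q' :: p' :: rev r2.
  by have := congr1 rev E2; rewrite rev_cat !rev_cons -!cats1 -catA.
suff : tp ([:: a, b & s1] ++ t ++ rev s2 ++ [:: c; d]) by rewrite /= -!catA.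
rewrite Er E1 -catA tpath_glue -E1 T1 -/([:: p, q & t] ++ [:: q', p' & rev r2]).
rewrite tpath_glue Ht /=.
suff : tp (rev (d :: c :: s2)) by rewrite E2 rev_cat.
by rewrite tpath_rev //; exact: edge_rev.
Qed.

(** The search through [permutations] keeps absorption boolean, so that absorbers can be counted as
    words. *)
Definition absorbs (v : 'I_n) (s : seq 'I_n) :=
  [&& tp s, 2 < size s &
    has (fun s' => tp s' && same_ends s s') (permutations (v :: s))].

Lemma absorbsP v s :
  reflect [/\ tp s, 2 < size s &
    exists s', [/\ perm_eq s' (v :: s), tp s' & same_ends s s']] (absorbs v s).
Proof.
apply: (iffP and3P) => -[Ts ss].
  by move=> /hasP[s' + /andP[]]; rewrite mem_permutations => ? ? ?; split=> //; exists s'.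
move=> [s' [p' T' e']]; split=> //; apply/hasP; exists s'; first by rewrite mem_permutations.
by rewrite T' e'.
Qed.

Hypothesis n1 : 1 < n.

Lemma card_lev j v : n <= K * #|[set x | lev j x && (x != v)]|.
Proof.
apply: leq_trans nK _; rewrite leq_mul2l; apply/orP; right.
(* One pair of vertices shows [8 f <= n], so the upper half has more than [f] vertices. *)
have : pair_deg E (Ordinal (ltnW n1)) (Ordinal n1) <= n.
  by rewrite -[leqRHS]card_ord max_card.
have /degE : Ordinal (ltnW n1) != Ordinal n1 by [].
have : #|'I_n| <= #|[set x | lev j x && (x != v)]| +
   (#|[set z : 'I_n | z < n./2]| + #|[set v]|).
  apply: leq_trans (leq_add (leqnn _) (leq_card_setU _ _)).
  apply: leq_trans (leq_card_setU _ _); rewrite -cardsT; apply: subset_leq_card.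
  apply/subsetP => z _; rewrite !inE /lev; case: (z == v); rewrite ?orbT ?andbT ?orbF //.
  by case: (ltnP z n./2); rewrite ?orbT //; lia.
have := card_low n./2; rewrite cards1 card_ord; lia.
Qed.

Let cN k (q : pred 'I_n) : n <= k * #|[set x | q x]| -> #|'I_n| <= k * #|[set x | q x]|.
Proof. by rewrite card_ord. Qed.

(* [x y z w] absorbs [v] as [x y v z w]. *)
Lemma absorbers_top v : lev K v -> dense 4 (K ^ 4) (absorbs v).
Proof.
move=> lv.
pose P1 s := if s is [:: y] then lev K y && (y != v) else false.
pose P2 s := if s is [:: y; z] then [&& lev K y, y != v, edge v y z & lev K z] else false.
pose P3 s := if s is [:: y; z; x] then
  [&& lev K y, y != v, edge v y z, lev K z, edge y z x & edge v y x] else false.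
pose P4 s := if s is [:: y; z; x; w] then
  [&& edge v y z, edge y z x, edge v y x, edge y z w & edge v z w] else false.
have B1 : dense 1 K P1.
  rewrite -[K]mul1n; apply: (dense_rcons (q := fun _ z => lev K z && (z != v)) dense_nil).
    by move=> s _ _; apply/cN/card_lev.
  by move=> [|//] z.
have B2 : dense 2 (K * K) P2.
  apply: (dense_rcons (q := fun s z => if s is [:: y] then
     [&& edge v y z, lev K z & z != v] else false) B1).
    move=> [|y []] //= _ /andP[ly yv]; apply/cN.
    by apply: nbr_lev_top => //; rewrite eq_sym.
  by move=> [|y []] //= z _ /andP[-> ->] /and3P[-> -> _].
have B3 : dense 3 (K * K * K) P3.
  apply: (dense_rcons (q := fun s x => if s is [:: y; z] then
     edge y z x && edge v y x else false) B2).
    move=> [|y [|z []]] //= _ /and4P[ly yv h lz]; apply/cN.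
    by apply: (common_nbr (j := K)) => //; [apply: edge_neq23 h | rewrite eq_sym].
  by move=> [|y [|z []]] //= x _ /and4P[-> -> -> ->] /andP[-> ->].
have B4 : dense 4 (K * K * K * K) P4.
  apply: (dense_rcons (q := fun s x => if s is [:: y; z; _] then
     edge y z x && edge v z x else false) B3).
    move=> [|y [|z [|x []]]] //= _ /and5P[ly yv h lz _]; apply/cN.
    by apply: (common_nbr (j := K)) => //; [apply: edge_neq23 h | apply: edge_neq13 h].
  by move=> [|y [|z [|x []]]] //= w _ /and5P[_ _ -> _ /andP[-> ->]] /andP[-> ->].
have -> : K ^ 4 = K * K * K * K by ring.
pose h (s : seq 'I_n) := if s is [:: y; z; x; w] then [:: x; y; z; w] else s.
pose g (s : seq 'I_n) := if s is [:: x; y; z; w] then [:: y; z; x; w] else s.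
apply: (dense_inj_in (f := h) (g := g) B4) => -[|y [|z [|x [|w []]]]] //= _.
move=> /and5P[h1 h2 h3 h4 h5]; apply/absorbsP; split=> //=.
  by rewrite edge_rot h2 h4.
exists [:: x; y; v; z; w]; split=> //=; last by rewrite /same_ends /= !eqxx.
  by rewrite -[[:: x, y, v & _]]/([:: x; y] ++ [:: v] ++ [:: z; w]) perm_catCA.
by rewrite (edge_rev x) h3 (edge_swap y) h1 h5.
Qed.

(* [y x y' x'] is a path in the common link of [v] and [u]: three edges of a
   4-cycle obtained by doubling both ends of one edge. *)
Lemma swaps j v : lev j v ->
  dense 5 (K ^ 12) (fun s => if s is [:: y; x; u; y'; x'] then
    [&& lev j.+1 u, tp s & tp [:: y; x; v; y'; x']] else false).
Proof.
move=> lv.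
pose P1 s := if s is [:: x] then lev j x && (x != v) else false.
pose P2 s := if s is [:: x; y] then [&& lev j x, edge v x y & lev j y] else false.
pose P3 s := if s is [:: x; y; u] then
  [&& edge v x y, lev j.+1 u & edge u x y] else false.
pose P3' s := if s is [:: u; x; y] then
  [&& edge v x y, lev j.+1 u & edge u x y] else false.
pose P4 s := if s is [:: u; x; y; y'] then
  [&& edge v x y, edge v x y', lev j.+1 u, edge u x y & edge u x y'] else false.
pose P4' s := if s is [:: u; y; y'; x] then
  [&& edge v x y, edge v x y', lev j.+1 u, edge u x y & edge u x y'] else false.
pose P5 s := if s is [:: u; y; y'; x; x'] then
    [&& lev j.+1 u, tp [:: y; x; u; y'; x'] & tp [:: y; x; v; y'; x']] else false.
have B1 : dense 1 K P1.
  rewrite -[K]mul1n; apply: (dense_rcons (q := fun _ z => lev j z && (z != v)) dense_nil).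
    by move=> s _ _; apply/cN/card_lev.
  by move=> [|//] z.
have B2 : dense 2 (K * K) P2.
  apply: (dense_rcons (q := fun s z => if s is [:: y] then
     [&& edge v y z, lev j.+1 z & z != v] else false) B1).
    move=> [|y []] //= _ /andP[ly yv]; apply/cN.
    by apply: nbr_lev => //; rewrite eq_sym.
  by move=> [|y []] //= z _ /andP[-> _] /and3P[-> lz _]; apply: levW lz.
have B3 : dense 3 (K * K * K) P3.
  apply: (dense_rcons (q := fun s u => if s is [:: x; y] then
     [&& edge x y u, lev j.+1 u & u != v] else false) B2).
    move=> [|y [|z []]] //= _ /and3P[ly h lz]; apply/cN.
    by apply: nbr_lev => //; apply: edge_neq23 h.
  by move=> [|x [|y []]] //= u _ /and3P[_ -> _] /and3P[+ -> _]; rewrite (edge_rot u).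
have B3' : dense (2 + 1) (K * K * K) P3'.
  pose h (s : seq 'I_n) := if s is [:: x; y; u] then [:: u; x; y] else s.
  pose g (s : seq 'I_n) := if s is [:: u; x; y] then [:: x; y; u] else s.
  by apply: (dense_inj_in (f := h) (g := g) B3) => -[|y [|z [|x []]]].
have B4 : dense (2 + (1 + 1)) ((K * K * K) ^ 2) P4.
  apply: (dense_double B3') => -[|u [|x []]] // [|y []] // [|y' []] //= _ _ _.
  by move=> /and3P[-> -> ->] /and3P[-> _ ->].
have B4' : dense (3 + 1) ((K * K * K) ^ 2) P4'.
  pose h (s : seq 'I_n) := if s is [:: u; x; y; y'] then [:: u; y; y'; x] else s.
  pose g (s : seq 'I_n) := if s is [:: u; y; y'; x] then [:: u; x; y; y'] else s.
  by apply: (dense_inj_in (f := h) (g := g) B4) => -[|y [|z [|x [|w []]]]].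
have B5 : dense (3 + (1 + 1)) (((K * K * K) ^ 2) ^ 2) P5.
  apply: (dense_double B4') => -[|u [|y [|y' []]]] // [|x []] // [|x' []] //= _ _ _.
  move=> /and5P[h1 h2 -> h3 h4] /and5P[h1' h2' _ h3' h4'].
  rewrite !(edge_rev y) h3 h1 (edge_swap x) h4 (edge_swap23 u) h4'.
  by rewrite (edge_swap x) h2 (edge_swap23 v) h2'.
have -> : K ^ 12 = ((K * K * K) ^ 2) ^ 2 by ring.
pose h (s : seq 'I_n) := if s is [:: u; y; y'; x; x'] then [:: y; x; u; y'; x'] else s.
pose g (s : seq 'I_n) := if s is [:: y; x; u; y'; x'] then [:: u; y; y'; x; x'] else s.
by apply: (dense_inj_in (f := h) (g := g) B5) => -[|y [|z [|x [|w [|w' []]]]]].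
Qed.

(** First [v] takes the place of [u] in the five-vertex path, then [t] absorbs the released [u]. The
    connector [c] sees only the first pair of [t], which absorption preserves. *)
Lemma absorbs_swap v y x u y' x' c t :
  tp [:: y; x; u; y'; x'] -> tp [:: y; x; v; y'; x'] ->
  absorbs u t -> tp (y' :: x' :: c ++ take 2 t) ->
  absorbs v ([:: y; x; u; y'; x'] ++ c ++ t).
Proof.
move=> T1 T2 /absorbsP[T3 t2 [t' [p' T' e']]] T4.
have t2' : 1 < size t' by rewrite (perm_size p') /= ltnS ltnW // ltnW.
have T : tp ([:: y; x; u; y'; x'] ++ c ++ t).
  rewrite -[_ ++ c ++ t]/([:: y; x; u] ++ y' :: x' :: c ++ t) tpath_glue T1 /=.
  have [a [b [r Er]]] := take2P (ltnW t2); subst t.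
  change (tp ((y' :: x' :: c) ++ a :: b :: r)); rewrite tpath_glue T3 andbT.
  by move: T4; rewrite /= take0.
apply/absorbsP; split=> //; exists ([:: y; x; v; y'; x'] ++ c ++ t'); split.
- apply/permP => p; have := permP p' p; rewrite /= !count_cat /=; count_lia.
- have T5 : tp ([:: y; x; v; y'; x'] ++ c ++ t).
    apply: (@tpath_swap _ edge [::] [:: y; x; u; y'; x'] [:: y; x; v; y'; x'] (c ++ t)) => //.
    by rewrite /same_ends /= !eqxx.
  have := @tpath_swap _ edge ([:: y; x; v; y'; x'] ++ c) t t' [::].
  by rewrite !cats0 -!catA; apply => //; exact: ltnW.
- rewrite /same_ends; apply/andP; split; first by rewrite /= eqxx.
  have [a [b [r Er]]] := take2_revP (ltnW t2); have [a' [b' [r' Er']]] := take2_revP t2'.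
  move: e'; rewrite /same_ends Er Er' !take2_rev_cat => /andP[_ /eqP[-> ->]].
  by rewrite !catA !take2_rev_cat.
Qed.

(** Induction on the number of levels missing below [K]; each exchange adds five vertices and a
    connector of [4K + 7]. *)
Lemma absorbers_lev i v : lev (K - i) v ->
  dense (4 + i * (4 * K + 12)) (K ^ (4 + i * (4 * K + 30))) (absorbs v).
Proof.
elim: i v => [|i IH] v lv; first by apply: absorbers_top; rewrite subn0 in lv.
have -> : 4 + i.+1 * (4 * K + 12) = 5 + ((4 * K + 7) + (4 + i * (4 * K + 12))) by lia.
have -> : K ^ (4 + i.+1 * (4 * K + 30)) = K ^ 12 * (K ^ (4 + i * (4 * K + 30)) * K ^ (4 * K + 18)).
  by rewrite -!expnD; congr (_ ^ _); lia.
set m := 4 + _.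
pose Q s (t : seq 'I_n) := absorbs v (s ++ t).
apply: (dense_cat (Q := Q) (swaps lv)) => // -[|y [|x [|u [|y' [|x' []]]]]] // _.
move=> /and3P[lu T1 T2].
have {}lu : lev (K - i) u by apply: levW lu; lia.
(* The connector is chosen after the absorber of [u] that it leads to, but precedes it on the
   path. *)
pose R (t : seq 'I_n) := absorbs v ([:: y; x; u; y'; x'] ++ drop m t ++ take m t).
suff B : dense (4 * K + 7 + m) (K ^ (4 + i * (4 * K + 30)) * K ^ (4 * K + 18)) R.
  apply: (dense_inj_in (f := fun t => drop m t ++ take m t)
    (g := fun t => drop (4 * K + 7) t ++ take (4 * K + 7) t) B) => t ht //.
    by rewrite drop_size_cat ?take_size_cat ?cat_take_drop // size_drop ht addnK.
  by rewrite size_cat addnC -size_cat cat_take_drop.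
rewrite addnC; apply: (dense_cat (Q := fun t c => tp (y' :: x' :: c ++ take 2 t)) (IH u lu)).
  move=> t ht /absorbsP[Tt t2 _]; have [a [b [r Er]]] := take2P (ltnW t2).
  rewrite Er /= take0; apply: connect_pairs.
    by move: T1 => /= /and4P[_ _ /edge_neq23].
  by move: Tt t2; rewrite Er; case: (r) => //= c r' /andP[/edge_neq12].
move=> t c ht hc At Tc; rewrite /R drop_size_cat // take_size_cat //.
exact: absorbs_swap.
Qed.

Lemma absorbers v :
  dense (4 + K * (4 * K + 12)) (K ^ (4 + K * (4 * K + 30))) (absorbs v).
Proof. by apply: absorbers_lev; rewrite subnn lev0. Qed.

End PosaGraph.

(** * Complete tripartite tiles *)

Lemma sum_pigeon (T : eqType) (r : seq T) (F : T -> nat) G :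
  0 < G -> G <= \sum_(x <- r) F x -> exists2 x, x \in r & G <= size r * F x.
Proof.
move=> G0 HG; have [/hasP[x rx Hx]|/hasPn H] := boolP (has (fun x => G <= size r * F x) r).
  by exists x.
have r0 : 0 < size r by case: r HG {H} => //; rewrite big_nil; lia.
exfalso; have : size r * \sum_(x <- r) F x <= \sum_(x <- r) G.-1.
  rewrite big_distrr /= big_seq [leqRHS]big_seq; apply: leq_sum => x /H.
  by rewrite -ltnNge; case: (G) G0 => // g _; rewrite ltnS.
rewrite sum_const_seq => H2; have : size r * G <= size r * G.-1.
  by apply: leq_trans (leq_trans _ H2) _; rewrite ?leq_mul2l ?HG ?orbT // mulnC.
by rewrite leq_pmul2l //; lia.
Qed.

(** * The Kovari-Sos-Turan argument *)

Section KST.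

(** Deleting an entry of least value never lowers the average. *)
Lemma rich_subseq (T : eqType) (Y : seq T) (F : T -> nat) k : k <= size Y ->
  exists Y0, [/\ subseq Y0 Y, size Y0 = k &
    k * \sum_(y <- Y) F y <= size Y * \sum_(y <- Y0) F y].
Proof.
move Em : (size Y) => m; elim: m Y Em => [|m IH] Y sY kY.
  by exists [::]; case: Y sY kY => // _; case: k.
move: kY; rewrite leq_eqVlt => /orP[/eqP ->|kY]; first by exists Y.
have [y0 Yy0 Hmin] : exists2 y0, y0 \in Y & forall y, y \in Y -> F y0 <= F y.
  case: Y sY {kY} => // a Y _; elim: Y a => [|b Y IHY] a.
    by exists a; rewrite ?inE // => y; rewrite inE => /eqP->.
  have [c cY Hc] := IHY b; case: (leqP (F a) (F c)) => ac.
    exists a; rewrite ?inE ?eqxx // => y; rewrite inE => /orP[/eqP->//|/Hc].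
    exact: leq_trans.
  exists c; first by rewrite inE cY orbT.
  by move=> y; rewrite inE => /orP[/eqP->|/Hc //]; apply: ltnW.
have sr : size (rem y0 Y) = m by rewrite size_rem // sY.
have [|Y0 [sub s0 H0]] := IH (rem y0 Y) sr; first by lia.
exists Y0; split=> //; first exact: subseq_trans sub (rem_subseq _ _).
have ES : \sum_(y <- Y) F y = F y0 + \sum_(y <- rem y0 Y) F y.
  by rewrite (perm_big _ (perm_to_rem Yy0)) big_cons.
have Hm : m * F y0 <= \sum_(y <- rem y0 Y) F y.
  have := sum_const_seq (rem y0 Y) (F y0); rewrite sr mulnC => <-.
  rewrite big_seq [leqRHS]big_seq; apply: leq_sum => y yr; exact/Hmin/(mem_rem yr).
rewrite ES; move: H0 Hm.
move: (\sum_(y <- rem y0 Y) F y) (\sum_(y <- Y0) F y) (F y0) => a b c H1 H2.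
have [m0|m0] := posnP m; first by have -> : k = 0 by lia.
rewrite -(leq_pmul2l m0).
apply: (@leq_trans (m.+1 * (k * a))); last by nia.
rewrite mulnDr mulnDr; apply: (@leq_trans (k * a + m * (k * a))); last by lia.
rewrite leq_add2r mulnCA leq_mul2l H2 orbT //.
Qed.

(** Only the [k = 2dt] richest entries of [Y] are kept. At least [1/(2d)] of [X] then have [t]
    neighbours among them, and by pigeonhole over the [2 ^ k] subsets many share the same [t]. *)
Lemma common_subseq (A B : eqType) (X : seq A) (Y : seq B) (r : A -> B -> bool) d t :
  0 < d -> 0 < t -> 2 * d * t <= size Y ->
  size X * size Y <= d * \sum_(x <- X) \sum_(y <- Y) r x y ->
  exists Y', [/\ subseq Y' Y, size Y' = t &
    size X <= 2 * d * 2 ^ (2 * d * t) * count (fun x => all (r x) Y') X].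
Proof.
move=> d0 t0 sY HXY; set k := 2 * d * t in sY *.
have [Y0 [sub s0 H0]] := rich_subseq (fun y => \sum_(x <- X) r x y) sY.
have k0 : 0 < k by rewrite /k !muln_gt0 d0 t0.
have Y0' : 0 < size Y by apply: leq_trans sY.
have {H0}HX : size X * k <= d * \sum_(x <- X) count (r x) Y0.
  rewrite exchange_big /= in HXY.
  under eq_bigr do rewrite count_sum.
  rewrite exchange_big /= -(leq_pmul2r Y0') -mulnA [k * _]mulnC mulnA.
  apply: leq_trans (leq_mul HXY (leqnn k)) _.
  by rewrite -!mulnA leq_mul2l [leqLHS]mulnC [leqRHS]mulnC H0 orbT.
pose good x := t <= count (r x) Y0.
have Hg : size X <= 2 * d * count good X.
  have : \sum_(x <- X) count (r x) Y0 <= k * count good X + t * size X.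
    rewrite count_sum big_distrr /= -sum_const_seq -big_split /=.
    apply: leq_sum => x _; rewrite /good; case: (leqP t _) => h.
      by rewrite muln1; apply: leq_trans (leq_addr _ _); rewrite -s0 count_size.
    by rewrite muln0 add0n ltnW.
  move: HX; rewrite /k; move: (\sum_(x <- X) _) (count _ _) (size X) => S g N HX HS.
  have : N * (d * t) <= (2 * d * g) * (d * t).
    have := leq_mul (leqnn d) HS; move: HX; clear; nia.
  by rewrite leq_pmul2r ?muln_gt0 ?d0.
(* With no good entry [X] is empty, and any [t] entries of [Y] serve. *)
have [g0|g0] := posnP (count good X).
  exists (take t Y); split; first exact: take_subseq.
    by rewrite size_takel //; apply: leq_trans sY; rewrite /k; nia.
  by move: Hg; rewrite g0 muln0 leqn0 => /eqP ->.
(* Subsets of [Y0] are bit masks; those of the wrong size count for nothing. *)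
pose c m := if size (mask m Y0) == t then count (fun x => all (r x) (mask m Y0)) X else 0.
have Hc : count good X <= \sum_(m <- words bool k) c m.
  have -> : \sum_(m <- words bool k) c m =
     \sum_(x <- X) \sum_(m <- words bool k) ((size (mask m Y0) == t) && all (r x) (mask m Y0)).
    rewrite exchange_big /=; apply: eq_bigr => m _; rewrite /c.
    case: eqP => _; first by rewrite count_sum.
    by rewrite big1.
  rewrite count_sum; apply: leq_sum => x _; rewrite -count_sum.
  case E : (good x) => //=; rewrite -has_count.
  have : subseq (take t (filter (r x) Y0)) Y0.
    exact: subseq_trans (take_subseq _ _) (filter_subseq _ _).
  case/subseqP => m sm Em; apply/hasP; exists m; first by rewrite mem_words sm s0.
  rewrite -Em size_takel ?eqxx ?size_filter //=.
  by apply/allP => y /mem_take; rewrite mem_filter => /andP[].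
have [m _ Hm] := sum_pigeon g0 Hc.
have cm : 0 < c m by case: (c m) Hm => //; rewrite muln0; lia.
exists (mask m Y0); move: cm Hm; rewrite /c; case: eqP => // Es _ Hm; split=> //.
  exact: subseq_trans (mask_subseq _ _) sub.
apply: leq_trans Hg _; rewrite -[leqRHS]mulnA leq_mul2l; apply/orP; right.
by apply: leq_trans Hm _; rewrite size_words card_bool.
Qed.

End KST.

(** * Extracting and cutting complete tripartite pieces *)

Section Tripartite.
Variables (V : eqType) (e : V -> V -> V -> bool).
Implicit Types (X Y Z : seq V).

Definition ntriples X Y Z := \sum_(x <- X) \sum_(y <- Y) \sum_(z <- Z) e x y z.

Definition complete X Y Z := all (fun x => all (fun y => all (e x y) Z) Y) X.

(** [D] is the inverse density left after one use of [common_subseq]. The factor before the last [t]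
    is what a second use loses, so [t] entries survive both. *)
Definition KST_bound d t := let D := 2 * d * 2 ^ (2 * d * t) in
  2 * D * 2 ^ (2 * D * t) * t.

(** The bipartite argument is applied to the pairs [(x, y)] against [Z], and then to [X] against [Y]
    with the pairs complete to [Z']. *)
Lemma KST3 d t X Y Z : 0 < d -> 0 < t ->
  KST_bound d t <= size X -> KST_bound d t <= size Y -> KST_bound d t <= size Z ->
  size X * size Y * size Z <= d * ntriples X Y Z ->
  exists X' Y' Z', [/\ subseq X' X /\ size X' = t, subseq Y' Y /\ size Y' = t,
    subseq Z' Z /\ size Z' = t & complete X' Y' Z'].
Proof.
move=> d0 t0; rewrite /KST_bound; set D := 2 * d * _ => HX HY HZ Hc.
have dD : d <= D by rewrite /D -mulnA mulnCA leq_pmulr // muln_gt0 expn_gt0.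
have D0 : 0 < D by apply: leq_trans dD.
set D2 := 2 * D * _ in HX HY HZ.
have DD2 : 2 * D <= D2 by rewrite /D2 leq_pmulr // expn_gt0.
have [||||Z' [sZ tZ]] := @common_subseq _ _ (allpairs pair X Y) Z (fun p z => e p.1 p.2 z) d t => //.
- apply: leq_trans HZ; rewrite leq_mul2r; apply/orP; right; lia.
- by rewrite size_allpairs /ntriples big_allpairs_dep.
rewrite size_allpairs -/D count_sum big_allpairs_dep /= => HD.
have [|Y' [sY tY HY']] := @common_subseq _ _ X Y (fun x y => all (e x y) Z') D t D0 t0 _ HD.
  by apply: leq_trans HY; rewrite leq_mul2r DD2 orbT.
pose G := filter (fun x => all (fun y => all (e x y) Z') Y') X.
have tG : t <= size G.
  rewrite size_filter; move: (leq_trans HX HY'); rewrite -/D2 leq_pmul2l //.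
  by apply: leq_trans DD2; lia.
exists (take t G), Y', Z'; split=> //.
  split; last by rewrite size_takel.
  exact: subseq_trans (take_subseq _ _) (filter_subseq _ _).
by apply/allP => x /mem_take; rewrite mem_filter => /andP[].
Qed.

Lemma cnt3_perm X X' Y Y' Z Z' :
  perm_eq X X' -> perm_eq Y Y' -> perm_eq Z Z' -> ntriples X Y Z = ntriples X' Y' Z'.
Proof.
move=> pX pY pZ; rewrite /ntriples (perm_big _ pX) /=; apply: eq_bigr => x _.
by rewrite (perm_big _ pY) /=; apply: eq_bigr => y _; rewrite (perm_big _ pZ).
Qed.

Lemma cnt3_cat1 X X' Y Z : ntriples (X ++ X') Y Z = ntriples X Y Z + ntriples X' Y Z.
Proof. by rewrite /ntriples big_cat. Qed.

Lemma cnt3_cat2 X Y Y' Z : ntriples X (Y ++ Y') Z = ntriples X Y Z + ntriples X Y' Z.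
Proof. by rewrite /ntriples -big_split; apply: eq_bigr => x _; rewrite big_cat. Qed.

Lemma cnt3_cat3 X Y Z Z' : ntriples X Y (Z ++ Z') = ntriples X Y Z + ntriples X Y Z'.
Proof.
rewrite /ntriples -big_split; apply: eq_bigr => x _; rewrite -big_split.
by apply: eq_bigr => y _; rewrite big_cat.
Qed.

Lemma cnt3_le X Y Z : ntriples X Y Z <= size X * size Y * size Z.
Proof.
rewrite /ntriples -mulnA mulnC -sum_const_seq; apply: leq_sum => x _.
rewrite mulnC -sum_const_seq; apply: leq_sum => y _.
by rewrite -count_sum count_size.
Qed.

Lemma completeP X Y Z :
  reflect (forall x y z, x \in X -> y \in Y -> z \in Z -> e x y z) (complete X Y Z).
Proof.
apply: (iffP allP) => [H x y z /H /allP Hx /Hx /allP Hy /Hy //|H x xX].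
by apply/allP => y yY; apply/allP => z zZ; apply: H.
Qed.

Lemma subset_complete X Y Z X' Y' Z' :
  {subset X' <= X} -> {subset Y' <= Y} -> {subset Z' <= Z} ->
  complete X Y Z -> complete X' Y' Z'.
Proof.
move=> sX sY sZ /completeP H; apply/completeP => x y z /sX hx /sY hy /sZ; exact: H.
Qed.

Lemma subseq_perm X X' : subseq X' X -> exists X2, perm_eq X (X' ++ X2).
Proof.
elim: X X' => [|x X IH] [|x' X'] //=; first by exists [::].
  by move=> _; exists (x :: X).
case: eqP => [->|_] /IH [X2 p2]; first by exists X2; rewrite perm_cons.
exists (x :: X2); apply/permP => p; have := permP p2 p; rewrite /= !count_cat /=; lia.
Qed.

(* [cl] will be the index of a vertex, divided by [f] and rounded down. *)
Variable cl : V -> nat.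

Definition grade_of X := head 0 (map cl X).
Definition homog X := all (fun x => cl x == grade_of X) X.

Lemma homogP X : homog X -> forall x, x \in X -> cl x = grade_of X.
Proof. by move=> /allP H x /H /eqP. Qed.

Lemma homog_sub X X' : {subset X' <= X} -> homog X -> homog X'.
Proof.
move=> sX hX; case: X' sX => // x X' sX; apply/allP => y yX.
by rewrite /grade_of /= (homogP hX (sX _ yX)) (homogP hX (sX _ (mem_head _ _))).
Qed.

Definition tile := (seq V * seq V * seq V)%type.
Definition tverts (T : tile) := T.1.1 ++ T.1.2 ++ T.2.
Definition allverts (L : seq tile) := flatten (map tverts L).
Definition is_tile t (T : tile) :=
  [&& size T.1.1 == t, size T.1.2 == t, size T.2 == t, homog T.1.1, homog T.1.2,
      homog T.2 & complete T.1.1 T.1.2 T.2].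

Lemma istileI t X Y Z : size X = t -> size Y = t -> size Z = t ->
  homog X -> homog Y -> homog Z -> complete X Y Z -> is_tile t (X, Y, Z).
Proof. by rewrite /is_tile /= => -> -> -> -> -> -> ->; rewrite eqxx. Qed.

Lemma perm_subr X X1 X2 : perm_eq X (X1 ++ X2) -> {subset X2 <= X}.
Proof. by move=> p x; rewrite (perm_mem p) mem_cat => ->; rewrite orbT. Qed.

(** Greedy removal: each complete piece taken out destroys at most [3 t s ^ 2] triples, and the
    surplus pays for [k] of them. *)
Lemma extract d t s k X Y Z : 0 < d -> 0 < t -> d * KST_bound d t <= s ->
  size X <= s -> size Y <= s -> size Z <= s -> homog X -> homog Y -> homog Z ->
  s ^ 3 + 3 * d * (k * t) * s ^ 2 <= d * ntriples X Y Z ->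
  exists L X1 X2 Y1 Y2 Z1 Z2,
   [/\ all (is_tile t) L, perm_eq (allverts L) (X1 ++ Y1 ++ Z1),
       perm_eq X (X1 ++ X2) /\ size X1 = k * t,
       perm_eq Y (Y1 ++ Y2) /\ size Y1 = k * t &
       perm_eq Z (Z1 ++ Z2) /\ size Z1 = k * t].
Proof.
move=> d0 t0 hs; elim: k X Y Z => [|k IH] X Y Z sX sY sZ hX hY hZ Hc.
  by exists [::], [::], X, [::], Y, [::], Z; split.
have s0 : 0 < s.
  apply: leq_trans hs; rewrite muln_gt0 d0 /KST_bound !muln_gt0 !expn_gt0 t0 /=.
  by rewrite ?andbT ?d0.
have Hs : s ^ 3 <= d * ntriples X Y Z by apply: leq_trans Hc; rewrite leq_addr.
have s2 : 0 < s ^ 2 by rewrite expn_gt0 s0.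
(* The triples number at least [s ^ 3 / d], which forces each part to have at least [s / d]
   vertices. *)
have big_enough U : ntriples X Y Z <= size U * s ^ 2 -> KST_bound d t <= size U.
  move=> HU; rewrite -(leq_pmul2l d0); apply: leq_trans hs _.
  rewrite -(leq_pmul2r s2) -expnS; apply: leq_trans Hs _.
  by rewrite -mulnA leq_mul2l HU orbT.
have Hcnt := cnt3_le X Y Z.
have [||||X' [Y' [Z' [[sbX tX] [sbY tY] [sbZ tZ] cT]]]] := @KST3 d t X Y Z d0 t0.
- apply: big_enough; apply: leq_trans Hcnt _; rewrite -mulnA leq_mul2l -mulnn.
  by rewrite leq_mul ?orbT.
- apply: big_enough; apply: leq_trans Hcnt _; rewrite -mulnA mulnCA leq_mul2l -mulnn.
  by rewrite leq_mul ?orbT.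
- apply: big_enough; apply: leq_trans Hcnt _; rewrite mulnC leq_mul2l -mulnn.
  by rewrite leq_mul ?orbT.
- apply: leq_trans Hs; rewrite !expnS expn0 muln1 mulnA; apply: leq_mul => //; exact: leq_mul.
have [X2 pX] := subseq_perm sbX; have [Y2 pY] := subseq_perm sbY.
have [Z2 pZ] := subseq_perm sbZ.
have Ht : ntriples X Y Z <= ntriples X2 Y2 Z2 + 3 * (t * s ^ 2).
  rewrite (cnt3_perm pX (perm_refl Y) (perm_refl Z)) cnt3_cat1.
  rewrite (cnt3_perm (perm_refl X2) pY (perm_refl Z)) cnt3_cat2.
  rewrite (cnt3_perm (perm_refl X2) (perm_refl Y2) pZ) cnt3_cat3.
  have sX2 : size X2 <= s.
    by apply: leq_trans sX; rewrite (perm_size pX) size_cat leq_addl.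
  have sY2 : size Y2 <= s.
    by apply: leq_trans sY; rewrite (perm_size pY) size_cat leq_addl.
  have h1 : ntriples X' Y Z <= t * s ^ 2.
    apply: leq_trans (cnt3_le _ _ _) _; rewrite tX -mulnA leq_mul2l -mulnn.
    by rewrite leq_mul ?orbT.
  have h2 : ntriples X2 Y' Z <= t * s ^ 2.
    apply: leq_trans (cnt3_le _ _ _) _; rewrite tY -mulnA mulnCA leq_mul2l -mulnn.
    by rewrite leq_mul ?orbT.
  have h3 : ntriples X2 Y2 Z' <= t * s ^ 2.
    apply: leq_trans (cnt3_le _ _ _) _; rewrite tZ mulnC leq_mul2l -mulnn.
    by rewrite leq_mul ?orbT.
  by move: h1 h2 h3; clear; move: (t * _) => g; lia.
have [|||||||L [X3 [X4 [Y3 [Y4 [Z3 [Z4 [aL pL [p1 s1] [p2 s2'] [p3 s3]]]]]]]]] := IH X2 Y2 Z2.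
- by apply: leq_trans sX; rewrite (perm_size pX) size_cat leq_addl.
- by apply: leq_trans sY; rewrite (perm_size pY) size_cat leq_addl.
- by apply: leq_trans sZ; rewrite (perm_size pZ) size_cat leq_addl.
- exact: homog_sub (perm_subr pX) hX.
- exact: homog_sub (perm_subr pY) hY.
- exact: homog_sub (perm_subr pZ) hZ.
- have := leq_mul (leqnn d) Ht; move: Hc; rewrite mulnDr.
  have -> : 3 * d * (k.+1 * t) * s ^ 2 = 3 * d * (k * t) * s ^ 2 + d * (3 * (t * s ^ 2)).
    by move: (s ^ 2) => g; clear; nia.
  move: (s ^ 3) (3 * d * _ * _) (d * (3 * _)) (d * ntriples _ _ _) (d * ntriples _ _ _).
  by clear; lia.
exists ((X', Y', Z') :: L), (X' ++ X3), X4, (Y' ++ Y3), Y4, (Z' ++ Z3), Z4; split.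
- rewrite /= aL andbT; apply: istileI => //.
  + exact: homog_sub (mem_subseq sbX) hX.
  + exact: homog_sub (mem_subseq sbY) hY.
  + exact: homog_sub (mem_subseq sbZ) hZ.
- apply/permP => p; have := permP pL p.
  by rewrite /allverts /= /tverts /= !count_cat; clear; lia.
- split; last by rewrite size_cat tX s1 mulSn.
  by apply/permP => p; have := permP pX p; have := permP p1 p; rewrite !count_cat; clear; lia.
- split; last by rewrite size_cat tY s2' mulSn.
  by apply/permP => p; have := permP pY p; have := permP p2 p; rewrite !count_cat; clear; lia.
- split; last by rewrite size_cat tZ s3 mulSn.
  by apply/permP => p; have := permP pZ p; have := permP p3 p; rewrite !count_cat; clear; lia.
Qed.

Lemma split_tile t j X Y Z : complete X Y Z -> homog X -> homog Y -> homog Z ->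
  size X = j * t -> size Y = j * t -> size Z = j * t ->
  exists L, all (is_tile t) L /\ perm_eq (allverts L) (X ++ Y ++ Z).
Proof.
elim: j X Y Z => [|j IH] X Y Z c hX hY hZ sX sY sZ.
  exists [::]; split=> //; move: sX sY sZ; rewrite mul0n.
  by move=> /size0nil -> /size0nil -> /size0nil ->.
have tk U : size U = j.+1 * t -> size (take t U) = t.
  by move=> sU; rewrite size_takel // sU mulSn leq_addr.
have dk U : size U = j.+1 * t -> size (drop t U) = j * t.
  by move=> sU; rewrite size_drop sU mulSn addKn.
have [|||||||L [aL pL]] := IH (drop t X) (drop t Y) (drop t Z).
- by apply: subset_complete c; exact: mem_drop.
- by apply: homog_sub hX; exact: mem_drop.
- by apply: homog_sub hY; exact: mem_drop.
- by apply: homog_sub hZ; exact: mem_drop.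
- exact: dk.
- exact: dk.
- exact: dk.
exists ((take t X, take t Y, take t Z) :: L); split.
  rewrite /= aL andbT; apply: istileI; rewrite ?tk //.
  - by apply: homog_sub hX; exact: mem_take.
  - by apply: homog_sub hY; exact: mem_take.
  - by apply: homog_sub hZ; exact: mem_take.
  - by apply: subset_complete c; exact: mem_take.
rewrite -{2}(cat_take_drop t X) -{2}(cat_take_drop t Y) -{2}(cat_take_drop t Z).
apply/permP => p; have := permP pL p; rewrite /allverts /= /tverts /= !count_cat; clear; lia.
Qed.

End Tripartite.

(** * Almost perfect tilings *)

Section Tiling.
Variables (n : nat) (E : {set {set 'I_n}}) (K f : nat).
Hypotheses (f0 : 0 < f) (nK : n <= K * f) (K0 : 0 < K).
Hypothesis degE : forall x y : 'I_n, x != y ->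
  minn (minn x y) n./2 + 8 * f <= pair_deg E x y.

Notation e := (edge E).
Definition cls (x : 'I_n) : nat := x %/ f.
Notation istile := (is_tile e cls).
Notation grade := (grade_of cls).
Notation homog := (homog cls).
Notation cnt3 := (ntriples e).

Lemma cls_lt x : cls x < K.
Proof. by rewrite /cls ltn_divLR //; apply: leq_trans nK. Qed.

(** Higher grades weigh less, so uncovering a higher grade instead of a lower one pays. All weights
    lie above [K] and at most at [2K], so covering two vertices at the cost of one pays whatever the
    grades. *)
Definition wt x := 2 * K - cls x.
Definition Psi (U : seq 'I_n) := \sum_(x <- U) wt x.

Lemma wt_bounds x : K < wt x <= 2 * K.
Proof. by have := cls_lt x; rewrite /wt; lia. Qed.

Lemma Psi_cat U U' : Psi (U ++ U') = Psi U + Psi U'.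
Proof. by rewrite /Psi big_cat. Qed.

Lemma Psi_perm U U' : perm_eq U U' -> Psi U = Psi U'.
Proof. by move=> p; rewrite /Psi (perm_big _ p). Qed.

Lemma Psi_le U : Psi U <= 2 * K * size U.
Proof.
by rewrite -sum_const_seq; apply: leq_sum => x _; have /andP[] := wt_bounds x.
Qed.

Lemma Psi_ge U : K.+1 * size U <= Psi U.
Proof.
by rewrite -sum_const_seq; apply: leq_sum => x _; have /andP[] := wt_bounds x.
Qed.

Lemma Psi_homog U A : {subset U <= A} -> homog A -> Psi U = (2 * K - grade A) * size U.
Proof.
move=> sU hA; by rewrite -sum_const_seq; apply: eq_big_seq => x xU; rewrite /wt (homogP hA (sU _ xU)).
Qed.

Lemma cnt3_flatten X Y L : cnt3 X Y (flatten L) = \sum_(Z <- L) cnt3 X Y Z.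
Proof.
elim: L => [|Z L IH]; last by rewrite big_cons /= cnt3_cat3 IH.
by rewrite big_nil /ntriples; apply: big1 => x _; apply: big1 => y _; rewrite big_nil.
Qed.

Lemma count_enum (p : pred 'I_n) : count p (enum 'I_n) = #|[set z | p z]|.
Proof.
rewrite cardE -size_filter; apply: perm_size; apply: uniq_perm.
- by rewrite filter_uniq ?enum_uniq.
- exact: enum_uniq.
- by move=> z; rewrite mem_filter !mem_enum !inE andbT.
Qed.

Lemma size_allverts s T : all (istile s) T -> size (allverts T) = 3 * s * size T.
Proof.
move=> aT; rewrite /allverts (@size_flatten_const _ (3 * s)) ?size_map //.
rewrite all_map; apply: sub_all aT => -[[X Y] Z] /and5P[/= /eqP sX /eqP sY /eqP sZ _ _].
by rewrite /tverts !size_cat /= sX sY sZ; apply/eqP; clear; lia.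
Qed.

Lemma cnt3_enum s A B : size A = s -> size B = s -> uniq (A ++ B) ->
  homog A -> homog B -> grade A = grade B ->
  s ^ 2 * (minn (grade A * f) n./2 + 8 * f) <= cnt3 A B (enum 'I_n).
Proof.
move=> sA sB; rewrite cat_uniq => /and3P[_ /hasPn dAB _] hA hB gAB.
set M := _ + 8 * f.
have -> : s ^ 2 * M = \sum_(x <- A) \sum_(y <- B) M.
  by rewrite !sum_const_seq sA sB -mulnn mulnC mulnA.
rewrite /ntriples big_seq [leqRHS]big_seq; apply: leq_sum => x xA.
rewrite big_seq [leqRHS]big_seq; apply: leq_sum => y yB.
have xy : x != y by apply: contraTneq xA => ->; exact: dAB.
rewrite -count_sum count_enum; apply: leq_trans (degE xy); rewrite leq_add2r.
have := homogP hA xA; have := homogP hB yB; rewrite -gAB => cy cx.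
have := leq_trunc_div x f; have := leq_trunc_div y f; rewrite -/(cls x) -/(cls y) cx cy.
by clear; lia.
Qed.

(** Lets a rich piece of a tile be assumed to come first. *)
Definition arrangements (T : tile 'I_n) : seq (tile 'I_n) :=
  let: (X, Y, Z) := T in
  [:: (X, Y, Z); (X, Z, Y); (Y, X, Z); (Y, Z, X); (Z, X, Y); (Z, Y, X)].

Lemma arrangementsP s T T' : T' \in arrangements T -> istile s T ->
  istile s T' /\ perm_eq (tverts T) (tverts T').
Proof.
case: T => [[X Y] Z]; rewrite /is_tile /tverts /= => H.
move=> /and5P[sX sY sZ hX /and3P[hY hZ /completeP c]].
have pp (U U' : seq 'I_n) : (forall p, count p U = count p U') -> perm_eq U U' by move/permP.
move: H; rewrite !inE => /or4P[/eqP->|/eqP->|/eqP->|/or3P[/eqP->|/eqP->|/eqP->]] /=;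
  (split; last by apply: pp => p; rewrite !count_cat; clear; lia);
  rewrite sX sY sZ hX hY hZ /=; apply/completeP => x y z xX yY zZ.
- exact: c.
- by rewrite edge_swap23; exact: c.
- by rewrite edge_swap; exact: c.
- by rewrite edge_rot edge_rot; exact: c.
- by rewrite edge_rot; exact: c.
- by rewrite edge_rev; exact: c.
Qed.

Definition rich s A B C := s ^ 3 <= K * cnt3 A B C.

(* Otherwise each tile has at most one rich piece and, beside it, a piece of
   grade at most that of [A]; the rich pieces then hold at most
   [(grade A + 1) f] vertices, and at most a third of all, fewer than the pair
   degrees demand. *)
Lemma useful_piece s A B T W J :
  0 < s -> size A = s -> size B = s -> uniq (A ++ B) -> homog A -> homog B -> grade A = grade B ->
  all (istile s) T -> all (fun C => size C == s) W ->
  perm_eq (allverts T ++ flatten W ++ J) (enum 'I_n) -> size J <= 3 * f ->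
  has (rich s A B) W || has (fun T0 => has (fun T1 : tile 'I_n => rich s A B T1.1.1 &&
     (rich s A B T1.1.2 || (grade A < grade T1.1.2) && (grade A < grade T1.2))) (arrangements T0)) T.
Proof.
move=> s0 sA sB uAB hA hB gAB aT aW pE sJ; apply/negPn; rewrite negb_or.
apply/negP => /andP[/hasPn HW /hasPn HT].
set D := rich s A B in HW HT; set k := grade A in HT *.
(* The number of rich pieces of a tile: by [HT] there are never two. *)
pose dl (T0 : tile 'I_n) : nat := [|| D T0.1.1, D T0.1.2 | D T0.2].
pose low (x : 'I_n) := cls x <= k.
have s2 : 0 < K * s ^ 2 by rewrite muln_gt0 K0 expn_gt0 s0.
have cl3 C : size C = s -> K * cnt3 A B C <= K * s ^ 3.
  move=> sC; rewrite leq_mul2l; apply/orP; right.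
  by apply: leq_trans (cnt3_le _ _ _ _) _; rewrite sA sB sC !expnS expn0 muln1 mulnA.
have nD C : ~~ D C -> K * cnt3 A B C <= s ^ 3 by rewrite /D /rich -ltnNge => /ltnW.
have sp T0 : T0 \in T -> [/\ size T0.1.1 = s, size T0.1.2 = s & size T0.2 = s].
  by move=> /(allP aT) /and5P[/eqP-> /eqP-> /eqP->].
have lowP C : size C = s -> homog C -> ~~ (k < grade C) -> s <= count low C.
  move=> sC hC gC; rewrite -{1}sC; have : all low C; last by rewrite all_count => /eqP->.
  by apply/allP => x /(homogP hC); rewrite /low => ->; rewrite leqNgt.
have H1 T0 : T0 \in T -> K * cnt3 A B (tverts T0) <= 3 * s ^ 3 + K * s ^ 3 * dl T0.
  move=> T0T; have [+ + +] := sp _ T0T; have := HT _ T0T.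
  case: (T0) => [[X Y] Z] /= + /cl3 + /cl3 + /cl3; rewrite /tverts !cnt3_cat3 /= !mulnDr /dl /=.
  have := @nD X; have := @nD Y; have := @nD Z; move: (D X) (D Y) (D Z) => dX dY dZ.
  move: (K * cnt3 A B X) (K * cnt3 A B Y) (K * cnt3 A B Z) (K * s ^ 3) (s ^ 3) => x y z u v.
  by clear; case: dX; case: dY; case: dZ => //=; lia.
have H2 T0 : T0 \in T -> s * dl T0 <= count low (tverts T0).
  move=> T0T; have [+ + +] := sp _ T0T; have := HT _ T0T.
  have /and5P[_ _ _ + /and3P[+ + _]] := allP aT _ T0T.
  case: (T0) => [[X Y] Z] /= hX hY hZ + sX sY sZ; rewrite /tverts !count_cat /dl /=.
  have := lowP X sX hX; have := lowP Y sY hY; have := lowP Z sZ hZ.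
  move: (D X) (D Y) (D Z) (k < _) (k < _) (k < _) (count _ _) (count _ _) (count _ _).
  by clear; do 6! case; move=> x y z /=; lia.
have szT := size_allverts aT.
have szW := size_flatten_const aW.
have szn : 3 * s * size T + s * size W <= n.
  have := perm_size pE; rewrite !size_cat szT szW size_enum_ord; clear; lia.
pose Delta := \sum_(T0 <- T) dl T0.
have HcT : K * cnt3 A B (allverts T) <= 3 * s ^ 3 * size T + K * s ^ 3 * Delta.
  rewrite cnt3_flatten big_map big_distrr /= /Delta [K * _ * _]big_distrr /=.
  rewrite -sum_const_seq -big_split /= big_seq [leqRHS]big_seq; exact: leq_sum.
have HcW : K * cnt3 A B (flatten W) <= s ^ 3 * size W.
  rewrite cnt3_flatten big_distrr /= -sum_const_seq big_seq [leqRHS]big_seq.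
  by apply: leq_sum => C /HW; rewrite /D /rich -ltnNge => /ltnW.
have HcJ : cnt3 A B J <= s ^ 2 * (3 * f).
  apply: leq_trans (cnt3_le _ _ _ _) _; rewrite sA sB mulnn leq_mul2l sJ orbT //.
(* Of the surplus [8 f] in the pair degrees, [J] accounts for at most [3 f] and all pieces that are
   not rich for at most [n/K <= f]. *)
have Hmain : minn (k * f) n./2 + 4 * f <= s * Delta.
  have := cnt3_enum sA sB uAB hA hB gAB.
  rewrite -(cnt3_perm e (perm_refl A) (perm_refl B) pE) !cnt3_cat3 -/k => H.
  rewrite -(leq_pmul2l s2).
  have {}H := leq_mul (leqnn K) H; have HK := leq_mul (leqnn K) HcJ.
  have Hn := leq_mul (leqnn (s ^ 2)) (leq_trans szn nK).
  move: H HK Hn HcT HcW.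
  have -> : s ^ 3 = s ^ 2 * s by rewrite -expnSr.
  move: (minn _ _) (cnt3 A B _) (cnt3 A B _) (cnt3 A B _) (s ^ 2) => m cT cW cJ g.
  move: Delta (size T) (size W) => dd tT tW; clear.
  have -> : K * (g * (m + 8 * f)) = K * g * (m + 4 * f) + 4 * (K * g * f) by ring.
  have -> : K * (g * (3 * f)) = 3 * (K * g * f) by ring.
  have -> : g * (K * f) = K * g * f by ring.
  have -> : g * (3 * s * tT + s * tW) = 3 * (g * s) * tT + g * s * tW by ring.
  have -> : K * (g * s) * dd = K * g * (s * dd) by ring.
  rewrite !mulnDr.
  move: (K * g * m) (K * g * (4 * f)) (K * g * f) (K * g * (s * dd)) (3 * (g * s) * tT) (g * s * tW).
  by clear; lia.
have HDl : Delta <= size T.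
  rewrite /Delta -[size T]mul1n -sum_const_seq; apply: leq_sum => T0 _.
  by rewrite /dl; case: (_ || _).
have Hlow : s * Delta <= k.+1 * f.
  apply: leq_trans (card_low n (k.+1 * f)).
  have <- : count low (enum 'I_n) = #|[set z : 'I_n | z < k.+1 * f]|.
    rewrite -count_enum; apply: eq_count => x; by rewrite /low /cls -ltnS ltn_divLR.
  rewrite -(permP pE) count_cat; apply: leq_trans (leq_addr _ _).
  rewrite count_flatten_sum big_map /Delta big_distrr /= big_seq [leqRHS]big_seq.
  exact: leq_sum.
have : 3 * s * Delta <= n.
  apply: leq_trans (leq_trans (leq_addr _ _) szn); by rewrite leq_mul2l HDl orbT.
move: Hmain Hlow f0; rewrite (mulSn k) -mulnA; move: (k * f) (s * Delta); clear.
by lia.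
Qed.

Ltac Psi_lia :=
  repeat match goal with |- context [Psi ?U] =>
    let c := fresh "c" in move: (Psi U) => c end; clear; lia.

(** A state during one round: old tiles [T], uncovered clusters [W], finer tiles [T'] already made,
    uncovered remainder [R], and vertices [F] kept out of the tiling. *)
Definition config s t (T : seq (tile 'I_n)) (W : seq (seq 'I_n)) (T' : seq (tile 'I_n))
  (R F : seq 'I_n) :=
  [/\ all (istile s) T, all (fun C => (size C == s) && homog C) W, all (istile t) T' &
      perm_eq (allverts T ++ flatten W ++ allverts T' ++ R ++ F) (enum 'I_n)].

(** With [q = k t], a rich triple has [s ^ 3 / K = 12 q s ^ 2] triples. A loss of [2 q s ^ 2], as
    when [A] and [B] have already given up [q] vertices each, leaves 10 of these 12 parts;
    extraction at inverse density [4K] needs [3 + 3]. *)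
Lemma rich_extract t k s A B C : 0 < t -> s = 12 * K * (k * t) ->
  4 * K * KST_bound (4 * K) t <= s ->
  size A <= s -> size B <= s -> size C <= s -> homog A -> homog B -> homog C ->
  s ^ 3 <= K * (cnt3 A B C + 2 * (k * t) * s ^ 2) ->
  exists L X1 X2 Y1 Y2 Z1 Z2,
   [/\ all (istile t) L, perm_eq (allverts L) (X1 ++ Y1 ++ Z1),
       perm_eq A (X1 ++ X2) /\ size X1 = k * t,
       perm_eq B (Y1 ++ Y2) /\ size Y1 = k * t &
       perm_eq C (Z1 ++ Z2) /\ size Z1 = k * t].
Proof.
move=> t0 Es hs sA sB sC hA hB hC H.
apply: (@extract _ e cls (4 * K) t s k A B C) => //; first by rewrite muln_gt0.
move: H; have -> : s ^ 3 = 12 * (K * (k * t) * s ^ 2).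
  by rewrite expnS {1}Es; ring.
have -> : K * (cnt3 A B C + 2 * (k * t) * s ^ 2) = K * cnt3 A B C + 2 * (K * (k * t) * s ^ 2).
  by ring.
have -> : 3 * (4 * K) * (k * t) * s ^ 2 = 12 * (K * (k * t) * s ^ 2) by ring.
rewrite -(mulnA 4 K); move: (K * (k * t) * s ^ 2) (K * cnt3 A B C) => a b; clear; lia.
Qed.

(** One improvement, with the cases of [useful_piece]. There [J] consists of [A], [B], the finer
    tiles, [R] and [F]: at most [2 s <= f] and [2 f] vertices. *)
Lemma step s t k (T : seq (tile 'I_n)) (W : seq (seq 'I_n)) T'
    (R F A B : seq 'I_n) W1 : 0 < t -> 0 < k -> s = 12 * K * (k * t) ->
  4 * K * KST_bound (4 * K) t <= s -> 2 * s <= f ->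
  config s t T W T' R F -> perm_eq W [:: A, B & W1] -> grade A = grade B ->
  size (allverts T') + size R + size F <= 2 * f ->
  exists T2 W2 T2' R2, [/\ config s t T2 W2 T2' R2 F, size W <= size W2 + 3,
    Psi (flatten W2 ++ R2) + k * t <= Psi (flatten W ++ R) &
    size (allverts T2') + size R2 <= size (allverts T') + size R + 6 * s].
Proof.
move=> t0 k0 Es hs sf [aT aW aT' pE] pW gAB sJ.
set q := k * t in Es *.
have q0 : 0 < q by rewrite muln_gt0 k0.
have s0 : 0 < s by rewrite Es muln_gt0 q0 muln_gt0 K0.
have qs : 12 * q <= s by rewrite Es -mulnA mulnCA leq_pmull.
have := aW; rewrite (perm_all _ pW) /= => /and3P[/andP[/eqP sA hA] /andP[/eqP sB hB] aW1].
have cW (p : pred 'I_n) : count p (flatten W) = count p A + count p B + count p (flatten W1).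
  rewrite !count_flatten_sum (perm_big _ pW) !big_cons /=; count_lia.
have pE1 : perm_eq (allverts T ++ flatten W1 ++ (A ++ B ++ allverts T' ++ R ++ F)) (enum 'I_n).
  apply/permP => p; rewrite -(permP pE) !count_cat cW; count_lia.
have uAB : uniq (A ++ B).
  have p2 : perm_eq ((A ++ B) ++ allverts T ++ flatten W1 ++ allverts T' ++ R ++ F) (enum 'I_n).
    by apply/permP => p; rewrite -(permP pE1) !count_cat; count_lia.
  by have := enum_uniq 'I_n; rewrite -(perm_uniq p2) cat_uniq => /and3P[].
have PsiW R' : Psi (flatten W ++ R') = Psi A + Psi B + Psi (flatten W1 ++ R').
  rewrite /Psi (perm_big (A ++ B ++ flatten W1 ++ R')) /= ?big_cat /= ?addnA //.
  apply/permP => p; rewrite !count_cat cW; count_lia.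
have sW : size W = (size W1).+2 by rewrite (perm_size pW).
have aW1s : all (fun C => size C == s) W1 by apply: sub_all aW1 => C /andP[].
have := useful_piece s0 sA sB uAB hA hB gAB aT aW1s pE1.
have -> : size (A ++ B ++ allverts T' ++ R ++ F) <= 3 * f.
  by rewrite !size_cat sA sB; move: sJ sf; count_lia.
(* A third uncovered cluster is rich with [A] and [B]: each gives [q] vertices to new tiles, and the
   rest of the three goes to [R]. *)
move=> /(_ isT) /orP[/hasP[C CW1 dC]|].
  have /andP[/eqP sC hC] := allP aW1 _ CW1.
  have [||||L [X1 [X2 [Y1 [Y2 [Z1 [Z2 [aL pL [pA sX1] [pB sY1] [pC sZ1]]]]]]]]] :=
    @rich_extract t k s A B C t0 Es hs _ _ _ hA hB hC; rewrite ?sA ?sB ?sC //.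
    by apply: leq_trans dC _; rewrite leq_mul2l leq_addr orbT.
  have cW1 p : count p (flatten W1) = count p C + count p (flatten (rem C W1)).
    by rewrite !count_flatten_sum (perm_big _ (perm_to_rem CW1)) big_cons.
  exists T, (rem C W1), (L ++ T'), (X2 ++ Y2 ++ Z2 ++ R).
  have sLT : size (allverts (L ++ T')) = 3 * q + size (allverts T').
    rewrite /allverts map_cat flatten_cat size_cat (perm_size pL) !size_cat sX1 sY1 sZ1 -/q.
    count_lia.
  have sX2 : s = q + size X2 by rewrite -sA (perm_size pA) size_cat sX1.
  have sY2 : s = q + size Y2 by rewrite -sB (perm_size pB) size_cat sY1.
  have sZ2 : s = q + size Z2 by rewrite -sC (perm_size pC) size_cat sZ1.
  split.
  - split=> //; first by apply/allP => D /mem_rem; exact: (allP aW1).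
      by rewrite all_cat aL.
    apply/permP => p; rewrite -(permP pE1) /allverts map_cat flatten_cat !count_cat cW1.
    have := permP pL p; rewrite /allverts (permP pA) (permP pB) (permP pC) !count_cat.
    count_lia.
  - by rewrite sW size_rem //; clear; case: (size W1) => //; lia.
  - rewrite PsiW !Psi_cat.
    have -> : Psi (flatten W1) = Psi C + Psi (flatten (rem C W1)).
      rewrite -Psi_cat; apply: Psi_perm; apply/permP => p; by rewrite count_cat cW1.
    rewrite (Psi_perm pA) (Psi_perm pB) (Psi_perm pC) !Psi_cat.
    have : q <= Psi X1 by apply: leq_trans (Psi_ge X1); rewrite sX1 leq_pmull.
    Psi_lia.
  - by rewrite sLT !size_cat; move: qs sX2 sY2 sZ2; count_lia.
case/hasP => T0 T0T /hasP[[[C1 C2] C3] T1T /= /andP[dC1 dC2]].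
have [/and5P[/= /eqP sC1 /eqP sC2 /eqP sC3 hC1 /and3P[hC2 hC3 cC]] pT1] :=
  arrangementsP T1T (allP aT _ T0T).
set Tr := rem T0 T.
have aTr : all (istile s) Tr by apply/allP => T2 /mem_rem; exact: (allP aT).
have cT (p : pred 'I_n) :
    count p (allverts T) = count p C1 + count p C2 + count p C3 + count p (allverts Tr).
  rewrite /allverts !count_flatten_sum !big_map (perm_big _ (perm_to_rem T0T)) big_cons.
  by rewrite (permP pT1) /tverts /= !count_cat !addnA.
have sj : s - q = (12 * K * k - k) * t by rewrite mulnBl -[_ * t]mulnA -Es.
have [||||L1 [X1 [X2 [Y1 [Y2 [Z1 [Z2 [aL1 pL1 [pA sX1] [pB sY1] [pC1 sZ1]]]]]]]]] :=
  @rich_extract t k s A B C1 t0 Es hs _ _ _ hA hB hC1; rewrite ?sA ?sB ?sC1 //.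
  by apply: leq_trans dC1 _; rewrite leq_mul2l leq_addr orbT.
have sX2 : size X2 = s - q by rewrite -sA (perm_size pA) size_cat sX1 addKn.
have sY2 : size Y2 = s - q by rewrite -sB (perm_size pB) size_cat sY1 addKn.
have sZ2 : size Z2 = s - q by rewrite -sC1 (perm_size pC1) size_cat sZ1 addKn.
have hZ2 : homog Z2 := homog_sub (perm_subr pC1) hC1.
have hX2 : homog X2 := homog_sub (perm_subr pA) hA.
have hY2 : homog Y2 := homog_sub (perm_subr pB) hB.
have sd : size (drop q C3) = s - q by rewrite size_drop sC3.
have stk : size (take q C3) = q by rewrite size_takel // sC3; move: qs; clear; lia.
have cC3 (p : pred 'I_n) : count p C3 = count p (take q C3) + count p (drop q C3).
  by rewrite -{1}(cat_take_drop q C3) count_cat.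
have hd : homog (drop q C3) := homog_sub (fun x => @mem_drop q _ C3 x) hC3.
have PA (U U1 U2 : seq 'I_n) : perm_eq U (U1 ++ U2) -> Psi U = Psi U1 + Psi U2.
  by move=> p; rewrite (Psi_perm p) Psi_cat.
have PsX : Psi X2 = (2 * K - grade A) * (s - q).
  by rewrite (Psi_homog (perm_subr pA) hA) sX2.
have PsY : Psi Y2 = (2 * K - grade A) * (s - q).
  by rewrite (Psi_homog (perm_subr pB) hB) sY2 gAB.
have PsA : Psi A = (2 * K - grade A) * s by rewrite (Psi_homog _ hA) ?sA.
have PsB : Psi B = (2 * K - grade A) * s by rewrite (Psi_homog _ hB) ?sB ?gAB.
case/orP: dC2 => [dC2|/andP[gC2 gC3]].
  (* [C1] and [C2] each take [q] vertices of [A] and of [B], and only [C3] loses [q]. *)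
  have Hc : cnt3 A B C2 <= cnt3 X2 Y2 C2 + 2 * q * s ^ 2.
    rewrite (cnt3_perm e pA (perm_refl B) (perm_refl C2)) cnt3_cat1.
    rewrite (cnt3_perm e (perm_refl X2) pB (perm_refl C2)) cnt3_cat2.
    have h1 : cnt3 X1 B C2 <= q * s * s.
      by apply: leq_trans (cnt3_le _ _ _ _) _; rewrite sX1 sB sC2.
    have h2 : cnt3 X2 Y1 C2 <= q * s * s.
      apply: leq_trans (cnt3_le _ _ _ _) _; rewrite sX2 sY1 sC2 -/q.
      by rewrite leq_mul2r [(s - q) * q]mulnC leq_mul2l leq_subr !orbT.
    have -> : 2 * q * s ^ 2 = 2 * (q * s * s) by ring.
    by move: h1 h2; move: (q * s * s) => w; clear; lia.
  have [||||L2 [X3 [X4 [Y3 [Y4 [Z3 [Z4 [aL2 pL2 [pX2 sX3] [pY2 sY3] [pC2 sZ3]]]]]]]]] :=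
    @rich_extract t k s X2 Y2 C2 t0 Es hs _ _ _ hX2 hY2 hC2; rewrite ?sX2 ?sY2 ?sC2 ?leq_subr //.
    by apply: leq_trans dC2 _; rewrite leq_mul2l Hc orbT.
  have sX4 : size X4 = s - q - q by rewrite -sX2 (perm_size pX2) size_cat sX3 addKn.
  have sY4 : size Y4 = s - q - q by rewrite -sY2 (perm_size pY2) size_cat sY3 addKn.
  have sZ4 : size Z4 = s - q by rewrite -sC2 (perm_size pC2) size_cat sZ3 addKn.
  have hZ4 : homog Z4 := homog_sub (perm_subr pC2) hC2.
  (* All three pieces of the broken tile keep [s - q] vertices, a multiple of [t], so what is left
     of it is cut into finer tiles. *)
  have [|||||||L3 [aL3 pL3]] := @split_tile _ e cls t (12 * K * k - k) Z2 Z4 (drop q C3).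
  - by apply: subset_complete cC; [exact: perm_subr pC1|exact: perm_subr pC2|exact: mem_drop].
  - by [].
  - by [].
  - by [].
  - by rewrite sZ2.
  - by rewrite sZ4.
  - by rewrite sd.
  exists Tr, W1, (L1 ++ L2 ++ L3 ++ T'), (X4 ++ Y4 ++ take q C3 ++ R); split.
  - split=> //; first by rewrite !all_cat aL1 aL2 aL3.
    apply/permP => p; rewrite -(permP pE1) /allverts !map_cat !flatten_cat !count_cat.
    have := permP pL1 p; have := permP pL2 p; have := permP pL3 p.
    rewrite /allverts -!/(allverts _) cT cC3 (permP pA) (permP pB) (permP pC1) (permP pC2) !count_cat.
    by rewrite (permP pX2) (permP pY2) !count_cat; count_lia.
  - by rewrite sW; clear; lia.
  - rewrite PsiW !Psi_cat (PA _ _ _ pA) (PA _ _ _ pB) (PA _ _ _ pX2) (PA _ _ _ pY2).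
    have := Psi_ge X1; have := Psi_ge X3; have := Psi_ge Y1; have := Psi_ge Y3.
    have := Psi_le (take q C3); rewrite stk sX1 sX3 sY1 sY3 -/q (mulSn K) -(mulnA 2 K).
    by move: (K * q); Psi_lia.
  - rewrite /allverts !map_cat !flatten_cat !size_cat -!/(allverts _).
    rewrite (perm_size pL1) (perm_size pL2) (perm_size pL3) !size_cat.
    rewrite sX1 sX3 sY1 sY3 sZ1 sZ3 sX4 sY4 sZ2 sZ4 sd stk -/q.
    by move: qs; count_lia.
(* [q] vertices of [A] and of [B] are traded for [q] vertices of [C2] and of [C3]. *)
have sd2 : size (drop q C2) = s - q by rewrite size_drop sC2.
have stk2 : size (take q C2) = q by rewrite size_takel // sC2; move: qs; clear; lia.
have cC2 (p : pred 'I_n) : count p C2 = count p (take q C2) + count p (drop q C2).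
  by rewrite -{1}(cat_take_drop q C2) count_cat.
have hd2 : homog (drop q C2) := homog_sub (fun x => @mem_drop q _ C2 x) hC2.
have [|||||||L3 [aL3 pL3]] := @split_tile _ e cls t (12 * K * k - k) Z2 (drop q C2) (drop q C3).
- by apply: subset_complete cC; [exact: perm_subr pC1|exact: mem_drop|exact: mem_drop].
- by [].
- by [].
- by [].
- by rewrite sZ2.
- by rewrite sd2.
- by rewrite sd.
exists Tr, W1, (L1 ++ L3 ++ T'), (X2 ++ Y2 ++ take q C2 ++ take q C3 ++ R); split.
- split=> //; first by rewrite !all_cat aL1 aL3.
  apply/permP => p; rewrite -(permP pE1) /allverts !map_cat !flatten_cat !count_cat.
  have := permP pL1 p; have := permP pL3 p.
  rewrite /allverts -!/(allverts _) cT cC2 cC3 (permP pA) (permP pB) (permP pC1) !count_cat.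
  by count_lia.
- by rewrite sW; clear; lia.
- rewrite PsiW !Psi_cat PsA PsB PsX PsY.
  have -> : Psi (take q C2) = (2 * K - grade C2) * q.
    by rewrite (Psi_homog _ hC2) ?stk2 // => x; exact: mem_take.
  have -> : Psi (take q C3) = (2 * K - grade C3) * q.
    by rewrite (Psi_homog _ hC3) ?stk // => x; exact: mem_take.
  have gK : grade A < K.
    by case: (A) sA hA s0 => [<- //|x A' _ _ _]; exact: cls_lt.
  have h2 : (2 * K - grade C2) * q + q <= (2 * K - grade A) * q.
    by rewrite -mulSnr leq_mul2r; apply/orP; right; move: gC2 gK; clear; lia.
  have h3 : (2 * K - grade C3) * q + q <= (2 * K - grade A) * q.
    by rewrite -mulSnr leq_mul2r; apply/orP; right; move: gC3 gK; clear; lia.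
  have -> : (2 * K - grade A) * s = (2 * K - grade A) * (s - q) + (2 * K - grade A) * q.
    by rewrite -mulnDr subnK //; move: qs; clear; lia.
  by move: h2 h3; move: (_ * q) (_ * q) (_ * q) (_ * (s - q)); Psi_lia.
- rewrite /allverts !map_cat !flatten_cat !size_cat -!/(allverts _).
  rewrite (perm_size pL1) (perm_size pL3) !size_cat.
  rewrite sX1 sY1 sZ1 sX2 sY2 sZ2 sd sd2 stk stk2 -/q.
  by move: qs; count_lia.
Qed.

(** While more than [K s] vertices remain, one of the [K] grades contains [s] of them. *)
Lemma cluster s (U : seq 'I_n) : 0 < s -> exists (W : seq (seq 'I_n)) R,
  [/\ all (fun C => (size C == s) && homog C) W, perm_eq U (flatten W ++ R) & size R <= K * s].
Proof.
move=> s0; elim: {U}(size U) {-2}U (leqnn (size U)) => [|m IH] U Um.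
  by exists [::], U; split=> //; apply: leq_trans Um _.
have [sU|sU] := leqP (size U) (K * s); first by exists [::], U.
have Hc : size U <= \sum_(k <- iota 0 K) count (fun x => cls x == k) U.
  under eq_bigr do rewrite count_sum.
  rewrite exchange_big /= -[leqLHS]mul1n -sum_const_seq; apply: leq_sum => x _.
  rewrite -count_sum -has_count; apply/hasP; exists (cls x) => //.
  by rewrite mem_iota /= cls_lt.
have [|k _ Hk] := sum_pigeon _ Hc; first by apply: leq_ltn_trans sU.
rewrite size_iota in Hk.
have sk : s <= size (filter (fun x => cls x == k) U).
  by rewrite size_filter -(leq_pmul2l K0); apply: leq_trans (ltnW sU) Hk.
set C := take s (filter (fun x => cls x == k) U).
have sbC : subseq C U := subseq_trans (take_subseq _ _) (filter_subseq _ _).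
have sC : size C = s by rewrite size_takel.
have hC : homog C.
  have H x : x \in C -> cls x = k by move/mem_take; rewrite mem_filter => /andP[/eqP].
  apply/allP => x xC; rewrite (H _ xC) /grade_of.
  by case: (C) xC H => // y C' _ H /=; rewrite H ?mem_head.
have [U2 pU] := subseq_perm sbC.
have [|W [R [aW pW sR]]] := IH U2.
  have := perm_size pU; rewrite size_cat sC; move: Um s0; count_lia.
exists (C :: W), R; split=> //=; first by rewrite sC hC eqxx.
apply/permP => p; rewrite (permP pU) !count_cat (permP pW) count_cat; count_lia.
Qed.

Lemma same_grade_pair s (W : seq (seq 'I_n)) : 0 < s ->
  all (fun C => (size C == s) && homog C) W -> K < size W ->
  exists A B W1, perm_eq W [:: A, B & W1] /\ grade A = grade B.
Proof.
move=> s0 aW KW.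
have : ~~ uniq (map grade W).
  apply: contraL KW => /uniq_leq_size H; rewrite -leqNgt -(size_map grade W) -[leqRHS](size_iota 0 K).
  apply: H => _ /mapP[C /(allP aW) /andP[/eqP sC _] ->]; rewrite mem_iota /=.
  by case: C {sC} => [|x C]; rewrite /grade_of /= add0n ?K0 ?cls_lt.
elim: W {aW KW} => [//|A W IH] /=; rewrite negb_and negbK => /orP[/mapP[B BW EB]|/IH].
  by exists A, B, (rem B W); split=> //; rewrite perm_cons perm_to_rem.
move=> [B [C [W1 [p g]]]]; exists B, C, (A :: W1); split=> //.
by apply/permP => q; have := permP p q; rewrite /=; count_lia.
Qed.

Lemma split_tiles t j (T : seq (tile 'I_n)) : all (istile (j * t)) T ->
  exists T2, all (istile t) T2 /\ perm_eq (allverts T2) (allverts T).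
Proof.
elim: T => [|[[X Y] Z] T IH] /=; first by exists [::].
move=> /andP[/and5P[/= /eqP sX /eqP sY /eqP sZ hX /and3P[hY hZ c]] /IH[T2 [a2 p2]]].
have [L [aL pL]] := split_tile c hX hY hZ sX sY sZ.
exists (L ++ T2); split; first by rewrite all_cat aL.
apply/permP => p; rewrite /allverts map_cat flatten_cat count_cat.
by rewrite (permP pL) (permP p2) /= /tverts !count_cat; count_lia.
Qed.

(** Each step costs up to three clusters and [6 s] vertices of the room in [J]; more than [K]
    clusters always contain two of equal grade. *)
Lemma steps s t k g T W T' R F : 0 < t -> 0 < k -> s = 12 * K * (k * t) ->
  4 * K * KST_bound (4 * K) t <= s -> 2 * s <= f ->
  config s t T W T' R F -> 3 * g + K <= size W ->
  size (allverts T') + size R + 6 * s * g + size F <= 2 * f ->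
  exists T2 W2 T2' R2, config s t T2 W2 T2' R2 F /\
    Psi (flatten W2 ++ R2) + g * (k * t) <= Psi (flatten W ++ R).
Proof.
move=> t0 k0 Es hs sf; elim: g T W T' R => [|g IH] T W T' R C gW sJ.
  by exists T, W, T', R; rewrite mul0n addn0.
have s0 : 0 < s by rewrite Es !muln_gt0 K0 k0.
have [_ aW _ _] := C.
have [|A [B [W1 [pW gAB]]]] := same_grade_pair s0 aW; first by move: gW; clear; lia.
have [|T2 [W2 [T2' [R2 [C2 sW2 P2 sJ2]]]]] := step t0 k0 Es hs sf C pW gAB.
  by apply: leq_trans sJ; rewrite leq_add2r leq_addr.
have [||T3 [W3 [T3' [R3 [C3 P3]]]]] := IH _ _ _ _ C2.
- by move: gW sW2; clear; lia.
- apply: leq_trans sJ; move: sJ2; rewrite mulnSr; move: (6 * s * g); count_lia.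
exists T3, W3, T3', R3; split=> //; apply: leq_trans P2.
by rewrite mulSnr addnA leq_add2r.
Qed.

Lemma round c s t k T U F : 0 < t -> 0 < k -> s = 12 * K * (k * t) ->
  4 * K * KST_bound (4 * K) t <= s -> 0 < c -> 4 * c * K * K * s * 12 <= n ->
  size F <= f -> all (istile s) T -> perm_eq (allverts T ++ U ++ F) (enum 'I_n) ->
  n <= c * size U ->
  exists T2 U2, [/\ all (istile t) T2, perm_eq (allverts T2 ++ U2 ++ F) (enum 'I_n) &
     288 * c * K * K * Psi U2 + n <= 288 * c * K * K * Psi U].
Proof.
move=> t0 k0 Es hs c0 nbig sF aT pE nU.
have s0 : 0 < s by rewrite Es !muln_gt0 K0 k0.
have [W [R [aW pU sR]]] := cluster U s0.
(* Small enough for the clusters and the room available, yet [n <= 24 c K s g]; since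
   [s = 12 K k t], the gain [g k t] is at least [n / (288 c K ^ 2)]. *)
set g := n %/ (12 * c * K * s).
have Bs0 : 0 < 12 * c * K * s by rewrite !muln_gt0 c0 K0.
have g1 : 12 * c * K * s * g <= n by rewrite mulnC leq_trunc_div.
have nb : 4 * K * (12 * c * K * s) <= n.
  by apply: leq_trans nbig; apply: eq_leq; ring.
have n0 : 0 < n by apply: leq_trans nb; rewrite !muln_gt0 K0 c0.
have Dn : 12 * c * K * s <= n.
  by apply: leq_trans nb; rewrite leq_pmull // muln_gt0.
have g2 : n <= 2 * (12 * c * K * s) * g.
  have g0 : 0 < g by rewrite divn_gt0.
  have := ltn_ceil n Bs0; rewrite -/g mulSn [g * _]mulnC -(mulnA 2).
  have := leq_pmulr (12 * c * K * s) g0; move: (12 * c * K * s) (g) => D g'.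
  by move: (D * g'); clear; lia.
have sf : 2 * K * s <= f.
  rewrite -(leq_pmul2l K0); apply: leq_trans nK; apply: leq_trans nb.
  have -> : 4 * K * (12 * c * K * s) = c * (24 * (K * (2 * K * s))) by ring.
  by apply: leq_trans (leq_pmull _ c0); rewrite leq_pmull.
have sgf : 12 * s * g <= f.
  rewrite -(leq_pmul2l K0); apply: leq_trans nK; apply: leq_trans g1.
  have -> : 12 * c * K * s * g = c * (K * (12 * s * g)) by ring.
  by rewrite leq_pmull.
(* Otherwise [c * size U] would be at most [3 c s g + 2 c K s], hence at most [n/4 + n/6]. *)
have gW : 3 * g + K <= size W.
  rewrite leqNgt; apply/negP => gW.
  have sW : size (flatten W) = s * size W.
    by apply: size_flatten_const; apply: sub_all aW => C /andP[].
  have h1 : s * size W <= s * (3 * g + K) by rewrite leq_mul2l ltnW ?orbT.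
  have h2 : size U <= s * (3 * g + K) + K * s.
    by rewrite (perm_size pU) size_cat sW leq_add.
  have h3 : n <= 3 * (c * s * g) + 2 * (c * K * s).
    apply: leq_trans nU _; apply: leq_trans (leq_mul (leqnn c) h2) _.
    by apply: eq_leq; ring.
  have h4 : 12 * (c * s * g) <= n.
    apply: leq_trans g1; have -> : 12 * c * K * s * g = K * (12 * (c * s * g)) by ring.
    by rewrite leq_pmull.
  have h5 : 12 * (c * K * s) <= n.
    by apply: leq_trans Dn; apply: eq_leq; ring.
  move: h3 h4 h5 n0; move: (c * s * g) (c * K * s); clear; lia.
have C : config s t T W [::] R F.
  split=> //; apply/permP => p; rewrite -(permP pE) !count_cat (permP pU) !count_cat /=.
  by count_lia.
have [||T2 [W2 [T2' [R2 [[aT2 _ aT2' pE2] P2]]]]] := steps t0 k0 Es hs _ C gW.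
- by apply: leq_trans sf; rewrite -mulnA leq_mul2l leq_pmull.
- rewrite /= add0n; move: sR sF sf sgf; rewrite -!mulnA; move: (K * s) (s * g).
  by count_lia.
rewrite Es mulnA in aT2; have [T3 [aT3 pT3]] := split_tiles aT2.
exists (T3 ++ T2'), (flatten W2 ++ R2); split.
- by rewrite all_cat aT3.
- apply/permP => p; rewrite -(permP pE2) /allverts map_cat flatten_cat !count_cat.
  by rewrite (permP pT3); count_lia.
have -> : Psi U = Psi (flatten W ++ R) by apply: Psi_perm.
apply: leq_trans (leq_mul (leqnn (288 * c * K * K)) P2); rewrite mulnDr leq_add2l.
by apply: leq_trans g2 _; rewrite Es; apply: eq_leq; ring.
Qed.

End Tiling.

(** Part sizes shrink from round to round, so the induction is for all [t]: to end with size [t],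
    the earlier rounds must end with a larger size. *)
Lemma rounds K c j t : 0 < K -> 0 < c -> 0 < t -> exists N0, forall n, N0 <= n ->
  forall (E : {set {set 'I_n}}) f (F : seq 'I_n), 0 < f -> n <= K * f ->
  (forall x y : 'I_n, x != y -> minn (minn x y) n./2 + 8 * f <= pair_deg E x y) ->
  uniq F -> size F <= f ->
  exists T U, [/\ all (is_tile (edge E) (cls f) t) T,
    perm_eq (allverts T ++ U ++ F) (enum 'I_n) &
    c * size U < n \/
    288 * c * K * K * Psi K f U + j * n <= 288 * c * K * K * (2 * K * n)].
Proof.
move=> K0 c0; elim: j t => [|j IH] t t0.
  exists 0 => n _ E f F f0 nK degE uF sF.
  have [U pU] : exists U, perm_eq (enum 'I_n) (F ++ U).
    exists (filter [predC (mem F)] (enum 'I_n)).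
    rewrite -(perm_filterC (mem F) (enum 'I_n)) perm_cat2r; apply: uniq_perm => //.
      by rewrite filter_uniq ?enum_uniq.
    by move=> x; rewrite mem_filter mem_enum andbT.
  exists [::], U; split=> //; first by rewrite perm_sym /= perm_catC in pU *.
  right; rewrite mul0n addn0 leq_mul2l; apply/orP; right.
  have sU : size U <= n by have := perm_size pU; rewrite size_cat size_enum_ord; count_lia.
  by apply: leq_trans (Psi_le f0 nK K0 U) _; rewrite leq_mul2l sU orbT.
(* With this [k] the earlier part size [12 K k t] is at least [4K] times the Kovari-Sos-Turan
   bound. *)
set k := KST_bound (4 * K) t.
have k0 : 0 < k by rewrite /k /KST_bound !muln_gt0 !expn_gt0 K0 t0.
have s0 : 0 < 12 * K * k * t by rewrite muln_gt0 t0 andbT muln_gt0 k0 andbT muln_gt0 K0.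
have [N0 HN] := IH _ s0.
exists (N0 + 4 * c * K * K * (12 * K * k * t) * 12) => n Nn E f F f0 nK degE uF sF.
have [T [U [aT pE H]]] := HN n (leq_trans (leq_addr _ _) Nn) E f F f0 nK degE uF sF.
have [Un|Un] := ltnP (c * size U) n.
  have [T2 [aT2 pT2]] := split_tiles aT.
  exists T2, U; split=> //; last by left.
  by apply: perm_trans pE; rewrite perm_cat2r.
case: H => [|H]; first by rewrite ltnNge Un.
have Es : 12 * K * k * t = 12 * K * (k * t) by rewrite mulnA.
have [||T2 [U2 [aT2 pE2 P2]]] := round f0 nK K0 degE t0 k0 Es _ c0 _ sF aT pE Un.
- rewrite -/k; have -> : 12 * K * k * t = (4 * K * k) * (3 * t) by ring.
  by rewrite leq_pmulr // muln_gt0.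
- exact: leq_trans (leq_addl _ _) Nn.
exists T2, U2; split=> //; right; apply: leq_trans H.
by rewrite mulSn addnA leq_add2r.
Qed.

(** The potential starts at no more than [2 K n], so [576 c K ^ 3 + 1] successful rounds would make
    it negative. *)
Lemma tiling K c t : 0 < K -> 0 < c -> 0 < t -> exists N0, forall n, N0 <= n ->
  forall (E : {set {set 'I_n}}) f (F : seq 'I_n), 0 < f -> n <= K * f ->
  (forall x y : 'I_n, x != y -> minn (minn x y) n./2 + 8 * f <= pair_deg E x y) ->
  uniq F -> size F <= f ->
  exists T U, [/\ all (is_tile (edge E) (cls f) t) T,
    perm_eq (allverts T ++ U ++ F) (enum 'I_n) & c * size U <= n].
Proof.
move=> K0 c0 t0; have [N0 HN] := rounds (576 * c * K * K * K).+1 K0 c0 t0.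
exists N0.+1 => n Nn E f F f0 nK degE uF sF.
have [T [U [aT pE H]]] := HN n (ltnW Nn) E f F f0 nK degE uF sF.
exists T, U; split=> //; case: H => [/ltnW //|H]; exfalso.
have n0 : 0 < n by apply: leq_trans Nn.
move: H; have -> : 288 * c * K * K * (2 * K * n) = 576 * c * K * K * K * n by ring.
rewrite (mulSn (576 * c * K * K * K)); move: (288 * c * K * K * _) (576 * c * K * K * K * n); move: n0; clear; lia.
Qed.

(** * Gluing and absorbing *)

Section Gluing.
Variables (n : nat) (E : {set {set 'I_n}}).
Hypothesis E3 : is_3graph E.
Implicit Types (P Q s X : seq 'I_n) (S L : seq (seq 'I_n)).
Notation tp := (tpath (edge E)).

Fixpoint weave X Y Z := match X, Y, Z with
  | x :: X', y :: Y', z :: Z' => x :: y :: z :: weave X' Y' Z'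
  | _, _, _ => [::]
  end.

(** Any three consecutive vertices of the cyclic interleaving lie in three different parts. *)
Lemma weaveP t (T : tile 'I_n) (cl : 'I_n -> nat) : is_tile (edge E) cl t T ->
  tp (weave T.1.1 T.1.2 T.2) /\ perm_eq (weave T.1.1 T.1.2 T.2) (tverts T).
Proof.
case: T => [[X Y] Z] /and5P[/= /eqP sX /eqP sY /eqP sZ _ /and3P[_ _ /completeP c]].
elim: X t Y Z sX sY sZ c => [|x X IH] t [|y Y] [|z Z] //=; try by move=> <-.
move=> <- [sY] [sZ] c.
have {}IH := IH _ _ _ erefl sY sZ (fun a b d aX bY dZ => c a b d (mem_behead (s := x :: X) aX)
  (mem_behead (s := y :: Y) bY) (mem_behead (s := z :: Z) dZ)).
split; last first.
  apply/permP => p; have := permP IH.2 p; rewrite /tverts /= !count_cat /= !count_cat /=.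
  by count_lia.
rewrite c ?mem_head //=; case: X Y Z c IH sY sZ => [|x' X] [|y' Y] [|z' Z] //= c [T' _] _ _.
by rewrite T' (edge_rot E y z) !(edge_rot E z x') !c ?inE ?eqxx ?orbT.
Qed.

(** At least one edge is present, so the first and the last pair consist of distinct vertices and
    can be connected. *)
Definition longpath P := tp P && (2 < size P).

Lemma longpath_first P : longpath P -> exists a b Q, P = a :: b :: Q /\ a != b.
Proof.
case: P => [|a [|b [|c P]]] // /andP[/= /andP[h _] _].
by exists a, b, (c :: P); split=> //; exact: edge_neq12 h.
Qed.

Lemma longpath_last P : longpath P -> exists a b Q, P = Q ++ [:: a; b] /\ a != b.
Proof.
move=> lP; have : longpath (rev P).
  by move: lP; rewrite /longpath size_rev tpath_rev //; exact: edge_rev.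
move=> /longpath_first[a [b [Q [EQ ab]]]]; exists b, a, (rev Q); split; last by rewrite eq_sym.
by rewrite -[P]revK EQ !rev_cons -!cats1 -catA.
Qed.

(* Vacuous on degenerate end pairs, so that connectors are dense for every index. *)
Definition connector (p : 'I_n * 'I_n * ('I_n * 'I_n)) s :=
  [&& p.1.1 != p.1.2 & p.2.1 != p.2.2] ==> tp (p.1.1 :: p.1.2 :: s ++ [:: p.2.1; p.2.2]).

(** Each gap uses one connector. [S] stays a list of blocks so that absorbers among them remain
    recognisable; the counting clauses track these and the connectors that are left. *)
Lemma glue Qs P L : longpath P -> all longpath Qs ->
  (forall p, size Qs <= count (connector p) L) ->
  exists S L', [/\ longpath (flatten (P :: S)),
    perm_eq (flatten (P :: S) ++ flatten L') (flatten (P :: Qs) ++ flatten L),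
    size (flatten L') <= size (flatten L),
    forall a : pred _, count a (P :: Qs) <= count a (P :: S) &
    forall a : pred _, count a L <= count a L' + size Qs].
Proof.
elim: Qs P => [|Q Qs IH] P lP /=.
  by move=> _ _; exists [::], L; split=> //=; rewrite ?cats0 // => a; rewrite addn0.
move=> /andP[lQ lQs] HL.
have [|S [L' [lS pS sL cS cL]]] := IH Q lQ lQs; first by move=> p; apply: ltnW.
have [a [b [P0 [EP ab]]]] := longpath_last lP.
have [c [d [Q0 [EQ cd]]]] := longpath_first lQ.
have : has (connector ((a, b), (c, d))) L'.
  rewrite has_count; have := HL ((a, b), (c, d)); have := cL (connector ((a, b), (c, d))).
  by count_lia.
move=> /hasP[r rL' ]; rewrite /connector /= ab cd /= => Tr.
exists [:: r, Q & S], (rem r L'); split.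
- move/andP: lS => [TS sS]; apply/andP; split; last first.
    by move: sS; rewrite /= !size_cat; count_lia.
  have HQ : tp (c :: d :: (Q0 ++ flatten S)) by move: TS; rewrite EQ.
  have -> : P ++ flatten [:: r, Q & S] = P0 ++ a :: b :: (r ++ c :: d :: (Q0 ++ flatten S)).
    by rewrite /= EP EQ -!catA.
  rewrite tpath_glue -EP; move/andP: lP => [-> _]; rewrite andTb.
  by change (tp ((a :: b :: r) ++ c :: d :: (Q0 ++ flatten S))); rewrite tpath_glue HQ andbT.
- have pr := perm_to_rem rL'.
  have cr p : count p (flatten L') = count p r + count p (flatten (rem r L')).
    by rewrite !count_flatten_sum (perm_big _ pr) big_cons.
  apply/permP => p; have := permP pS p; rewrite /= !count_cat cr; count_lia.
- apply: leq_trans sL; rewrite !size_flatten /shape !sumnE !big_map.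
  by rewrite [leqRHS](perm_big _ (perm_to_rem rL')) big_cons leq_addl.
- by move=> p; have := cS p; rewrite /=; count_lia.
- move=> p; have := cL p; rewrite (permP (perm_to_rem rL')) /=.
  by case: (p r); count_lia.
Qed.

Lemma take2_cat_same s b b' s' : 1 < size b -> 1 < size b' -> take 2 b' = take 2 b ->
  take 2 (s ++ b' ++ s') = take 2 (s ++ b ++ s').
Proof.
case: b => [|x [|y b]] //; case: b' => [|x' [|y' b']] // _ _ /=; rewrite !take0 => -[-> ->].
by case: s => [|? [|? ?]] /=; rewrite ?take0.
Qed.

(** Each vertex of [X] uses up one absorber, whose block changes only inside its end pairs. The
    first pair is preserved so that a cycle can still be closed there. *)
Lemma absorb_all X S post : tp (flatten S ++ post) ->
  (forall v, size X <= count (absorbs E v) S) ->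
  exists P, [/\ tp (P ++ post), perm_eq P (X ++ flatten S) & take 2 P = take 2 (flatten S)].
Proof.
elim: X S => [|v X IH] S TS HX; first by exists (flatten S).
have : has (absorbs E v) S by rewrite has_count; apply: leq_trans (HX v).
move=> /hasP[b bS Ab]; move: TS HX; case/splitPr: bS => S1 S2 TS HX.
have [Tb sb [b' [pb Tb' eb]]] := absorbsP _ _ _ Ab.
have sb' : 1 < size b' by rewrite (perm_size pb) /= ltnS ltnW // ltnW.
have [||P [TP pP tkP]] := IH (S1 ++ b' :: S2).
- move: TS; rewrite !flatten_cat /= -!catA => TS.
  by apply: tpath_swap TS Tb' => //; exact: ltnW.
- by move=> w; have := HX w; rewrite !count_cat /=; case: (absorbs E w b); count_lia.
exists P; split=> //.
  apply/permP => p; have := permP pb p; rewrite (permP pP) /= !count_cat !flatten_cat /= !count_cat.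
  by case: (p v); count_lia.
rewrite tkP !flatten_cat /=; apply: take2_cat_same => //; first exact: ltnW.
by case/andP: eb => /eqP.
Qed.

(** Repeating the first pair at the end makes the two wrap-around edges ordinary consecutive
    triples. *)
Lemma cycle_ham s : 3 < n -> perm_eq s (enum 'I_n) -> tp (s ++ take 2 s) -> tight_ham_cycle E.
Proof.
move=> n3 ps Ts; have sn : size s = n by rewrite (perm_size ps) size_enum_ord.
exists s; split=> //; first by rewrite (perm_uniq ps) enum_uniq.
have nthP (u : seq 'I_n) x0 i : tp u -> i.+2 < size u ->
    [set nth x0 u i; nth x0 u i.+1; nth x0 u i.+2] \in E.
  elim: u i => [|x u IH] [|i] //=.
    by case: u IH => [|y [|z u]] //= _ /andP[].
  by move=> T iu; apply: IH => //; case: (u) T iu => [|y [|z u']] //= /andP[].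
move=> x0 i i_n; have := nthP _ x0 i Ts.
have s2 : size (take 2 s) = 2 by rewrite size_takel // sn; apply: ltnW; apply: ltnW.
have ntm j : j < n + 2 -> nth x0 (s ++ take 2 s) j = nth x0 s (j %% n).
  move=> jn; rewrite nth_cat sn; case: ltnP => nj; first by rewrite modn_small.
  rewrite nth_take; last by move: jn nj; clear; lia.
  by rewrite -{2}(subnK nj) modnDr modn_small //; move: jn nj n3; clear; lia.
rewrite size_cat sn s2 !ntm; try by move: i_n; clear; lia.
by rewrite (modn_small i_n) addn1 !addn2 !ltnS; apply.
Qed.

End Gluing.

(** Connectors are indexed by two pairs of vertices, [n ^ 4] indices in all; this bounds their
    number as [selection] requires. *)
Lemma pow4_le_exp2 D n : 0 < D -> 64 * D * D <= n -> n ^ 4 <= 2 ^ (n %/ D).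
Proof.
move=> D0 nD; set w := n %/ D; set u := w %/ 8.
have w0 : 64 * D <= w by rewrite leq_divRL.
have u0 : 8 * D <= u by rewrite leq_divRL //; move: w0; clear; lia.
have nw : n <= D * w.+1 by rewrite mulnC ltnW // ltn_ceil.
have wu : w.+1 <= 8 * u.+1 by rewrite mulnC ltn_ceil.
have H : n <= 2 ^ (2 * u).
  apply: leq_trans nw _; apply: leq_trans (leq_mul (leqnn D) wu) _.
  rewrite mulnA [D * 8]mulnC mul2n -addnn expnD.
  by apply: leq_mul; [apply: leq_trans u0 (ltnW (ltn_expl _ _))|exact: ltn_expl].
apply: (@leq_trans ((2 ^ (2 * u)) ^ 4)); first by rewrite leq_exp2r.
rewrite -expnM leq_exp2l //; have := leq_trunc_div w 8; rewrite -/u; clear; lia.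
Qed.

(** * The Hamiltonian cycle *)

Lemma dense_connector (n : nat) (E : {set {set 'I_n}}) K f :
  is_3graph E -> 0 < f -> 0 < K -> n <= K * f ->
  (forall x y : 'I_n, x != y -> minn (minn x y) n./2 + 8 * f <= pair_deg E x y) ->
  forall p, dense (4 * K + 7) (K ^ (4 * K + 18)) (connector E p).
Proof.
move=> E3 f0 K0 nK degE [[a b] [c d]]; rewrite /connector /=.
have [/andP[ab cd]|_] := boolP ((a != b) && (c != d)); first exact: (connect_pairs E3 f0 nK degE).
by rewrite /dense /cnt count_predT size_words leq_pmull // expn_gt0 K0.
Qed.

Lemma posa_tight_ham K : 0 < K -> exists N0, forall n, N0 <= n ->
  forall (E : {set {set 'I_n}}) f, is_3graph E -> 0 < f -> n <= K * f ->
  (forall x y : 'I_n, x != y -> minn (minn x y) n./2 + 8 * f <= pair_deg E x y) ->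
  tight_ham_cycle E.
Proof.
move=> K0.
set l := 4 * K + 7; set C1 := K ^ (4 * K + 18).
set m := 4 + K * (4 * K + 12); set C2 := K ^ (4 + K * (4 * K + 30)).
have C10 : 0 < C1 by rewrite expn_gt0 K0.
have C20 : 0 < C2 by rewrite expn_gt0 K0.
have l0 : 0 < l by rewrite /l addnS.
(* Per unit of [w] below, [r] connectors are reserved for the final cycle, [a]
   absorbers are chosen, and [b] connectors are available for gluing these. *)
pose r := 8 * C1; pose a := 8 * C2 * (2 * (l * r)); pose b := 8 * C1 * a.
pose p := m * a + l * b.
(* [D] dominates the constants in the size conditions of the three selections and of the tiling. It
   is also the part size, so that there are fewer than [w] tiles. *)
pose D := K * (p + l * r) + 2 * C1 * (l * (l + l * b)) +
  2 * C2 * (m * (m + l * b + m * a)) + 2 * C1 * (l * (l + p + l * r)) + 1.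
have D0 : 0 < D by rewrite /D addn1.
have [N1 HN1] := @tiling K (2 * D) D K0 (ltac:(by rewrite muln_gt0)) D0.
exists (N1 + 64 * D * D + 4) => n Nn E f E3 f0 nK degE.
have n1 : N1 <= n by apply: leq_trans Nn; rewrite -addnA leq_addr.
have n2 : 64 * D * D <= n by apply: leq_trans Nn; rewrite addnAC leq_addl.
have n3 : 3 < n by apply: leq_trans Nn; rewrite addnS ltnS addnS addnS addnS !ltnS leq_addl.
set w := n %/ D.
have w2 : 2 <= w.
  rewrite leq_divRL //; apply: leq_trans n2; rewrite -mulnA mulnA.
  by rewrite leq_mul2r -(mulnC D); move: D0; clear; lia.
have Dw : D * w <= n by rewrite mulnC leq_trunc_div.
have nw : n < D * w.+1 by rewrite mulnC ltn_ceil.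
have n4 q : w <= q -> n ^ 4 <= 2 ^ q.
  by move=> wq; apply: leq_trans (pow4_le_exp2 D0 n2) _; rewrite leq_exp2l.
have V0 : 0 < #|'I_n| by rewrite card_ord; apply: leq_trans n3.
have cI : #|{: 'I_n * 'I_n * ('I_n * 'I_n)}| = n ^ 4.
  by rewrite !card_prod !card_ord; ring.
have small X : X <= D -> X * w <= n.
  by move=> h; apply: leq_trans Dw; rewrite leq_mul2r h orbT.
have w1 : 0 < w by apply: ltnW.
have mp x y : 0 < x -> 0 < y -> 0 < x * y by move=> x0 y0; rewrite muln_gt0 x0.
have r0 : 0 < r by apply: mp.
have lr0 : 0 < 2 * (l * r) by apply: (mp) => //; apply: (mp).
have a0 : 0 < a by apply: (mp) => //; apply: (mp).
have addw x y : x + y * w <= (x + y) * w by rewrite mulnDl leq_add2r leq_pmulr.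
have [inD1 inD2 inD3 inD4] : [/\ 2 * C1 * (l * (l + l * b)) <= D,
    2 * C2 * (m * (m + l * b + m * a)) <= D, 2 * C1 * (l * (l + p + l * r)) <= D &
    K * (p + l * r) <= D].
  rewrite /D; split; move: (K * _) (2 * C1 * _) (2 * C2 * _) (2 * C1 * _) => ? ? ? ?;
    by clear; lia.
have dC := dense_connector E3 f0 K0 nK degE.
have n1' : 1 < n by apply: leq_trans n3.
have dA := absorbers E3 f0 nK degE n1'.
(* As many connectors for every index as there will be absorbers to glue. *)
have [||L0 [sL0 aL0 uL0 HL0]] := @selection _ _ l C1 (connector E) [::] (a * w) V0 C10 isT dC.
- rewrite cI; apply: n4; exact: leq_pmull.
- rewrite card_ord addn0; apply: leq_trans (small _ inD1).
  have -> : l * (8 * C1 * (a * w)) = l * b * w by rewrite /b; ring.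
  by rewrite -(mulnA (2 * C1) _ w) -(mulnA l (_ + _) w) !leq_mul2l addw !orbT.
rewrite cats0 in uL0.
have szL0 : size (flatten L0) = l * b * w.
  by rewrite (size_flatten_const aL0) sL0 /b; ring.
(* Each vertex gets [2 l r w] absorbers: enough for at most [w] uncovered vertices and the [l r w]
   vertices of reserved connectors. *)
have [||Af [sA aA uA HA]] := @selection _ _ m C2 (absorbs E) (flatten L0) (2 * (l * r) * w) V0 C20 uL0 dA.
- rewrite card_ord; apply: (@leq_trans (n ^ 4)).
    by rewrite -{1}[n]expn1 leq_pexp2l // ltnW.
  by apply: n4; exact: leq_pmull.
- rewrite card_ord szL0; apply: leq_trans (small _ inD2).
  have -> : m * (8 * C2 * (2 * (l * r) * w)) = m * a * w by rewrite /a; ring.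
  rewrite -(mulnA (2 * C2) _ w) -(mulnA m (_ + _) w) !leq_mul2l.
  by rewrite -(addnA m (_ * w)) -(addnA m (_ * b)) -mulnDl addw !orbT.
have szA : size (flatten Af) = m * a * w.
  by rewrite (size_flatten_const aA) sA /a; ring.
(* A chosen word need not be a tight path; those that are not absorb nothing and are dropped. *)
set B := filter (longpath E) Af.
have cB (q : pred 'I_n) : count q (flatten B) <= count q (flatten Af).
  rewrite -(permP (perm_flatten (permEl (perm_filterC (longpath E) Af))) q).
  by rewrite flatten_cat count_cat leq_addr.
have HB v : 2 * (l * r) * w <= count (absorbs E v) B.
  rewrite count_filter; apply: leq_trans (HA v) _; apply: sub_count => s As /=.
  by rewrite As; have /absorbsP[Ts ss _] := As; rewrite /longpath Ts.
have lB : all (longpath E) B by apply: filter_all.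
have sB : size B <= a * w.
  by rewrite size_filter; apply: leq_trans (count_size _ _) _; rewrite sA /a; apply: eq_leq; ring.
have uB : uniq (flatten B ++ flatten L0).
  have pB : perm_eq (flatten Af) (flatten (filter (predC (longpath E)) Af) ++ flatten B).
    rewrite -flatten_cat; apply: perm_flatten.
    by rewrite perm_sym perm_catC; exact: (permEl (perm_filterC _ _)).
  have p2 : perm_eq (flatten Af ++ flatten L0)
      (flatten (filter (predC (longpath E)) Af) ++ flatten B ++ flatten L0).
    by rewrite catA perm_cat2r.
  by move: uA; rewrite (perm_uniq p2) cat_uniq => /and3P[].
have szB : size (flatten B) <= m * a * w.
  by rewrite -szA -!count_predT cB.
case EB : B lB sB uB szB HB => [|P Qs] lB sB uB szB HB.
  by have := HB (Ordinal (ltnW n1')); rewrite leqn0 muln_eq0; move: lr0 w1; clear; lia.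
have /andP[lP lQs] := lB.
have [|S0 [L0' [lPA pP _ cP _]]] := glue E3 (L := L0) lP lQs.
  by move=> q; apply: leq_trans (HL0 q); apply: ltnW.
set PA := flatten (P :: S0) in lPA pP.
have uPA : uniq PA.
  by move: uB; rewrite -(perm_uniq pP) cat_uniq => /andP[].
have szPA : size PA <= p * w.
  have h : size PA + size (flatten L0') = size (flatten (P :: Qs)) + l * b * w.
    by rewrite -szL0 -!size_cat; exact: perm_size pP.
  apply: leq_trans (leq_addr (size (flatten L0')) _) _.
  by rewrite h /p mulnDl leq_add2r.
have [||L [sL aL uL HL]] := @selection _ _ l C1 (connector E) PA w V0 C10 uPA dC.
- rewrite cI; exact: n4.
- rewrite card_ord; apply: leq_trans (small _ inD3).
  have -> : l * (8 * C1 * w) = l * r * w by rewrite /r; ring.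
  rewrite -(mulnA (2 * C1) _ w) -(mulnA l (_ + _ + _) w) !leq_mul2l.
  apply/orP; right; apply/orP; right; rewrite -(addnA l p) -(addnA l).
  by apply: leq_trans (addw _ _); rewrite leq_add2l mulnDl leq_add2r.
have szL : size (flatten L) = l * r * w.
  by rewrite (size_flatten_const aL) sL /r; ring.
have [|T [U [aT pE szU]]] := HN1 n n1 E f (flatten L ++ PA) f0 nK degE uL.
  rewrite -(leq_pmul2l K0); apply: leq_trans nK; apply: leq_trans (small _ inD4).
  by rewrite -mulnA leq_mul2l size_cat szL mulnDl addnC leq_add2r szPA orbT.
have lw0 : 0 < l * r by apply: (mp).
have sU : size U <= w.
  have : D * (2 * size U) < D * w.+1 by rewrite mulnA (mulnC D); apply: leq_ltn_trans nw.
  by rewrite ltn_pmul2l //; clear; lia.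
(* Strict, since one connector beyond those for the tiles is needed to close the cycle. *)
have sT : size T < w.
  have := perm_size pE; rewrite size_cat size_enum_ord (size_allverts aT) => h.
  have : D * (3 * size T) < D * w.+1.
    rewrite mulnA (mulnC D); apply: leq_ltn_trans nw.
    exact: leq_trans (leq_addr _ _) (eq_leq h).
  by rewrite ltn_pmul2l //; move: w2; clear; lia.
pose tw (T0 : tile 'I_n) := weave T0.1.1 T0.1.2 T0.2.
have ltw : all (longpath E) (map tw T).
  apply/allP => _ /mapP[T0 T0T ->]; have [Tw pw] := weaveP (allP aT _ T0T).
  rewrite /longpath Tw (perm_size pw) /=; case/and5P: (allP aT _ T0T) => /eqP h1 /eqP h2 /eqP h3 _ _.
  by rewrite /tverts !size_cat h1 h2 h3; move: D0; clear; lia.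
have ptw : perm_eq (flatten (map tw T)) (allverts T).
  elim: (T) aT => [|T0 T1 IH] //= /andP[aT0 /IH pT1].
  by rewrite perm_cat // (weaveP aT0).2.
have [|S [L' [lZ pZ sL' _ cL]]] := glue E3 (L := L) lPA ltw.
  by move=> q; apply: leq_trans (HL q); rewrite size_map ltnW.
have [c [d [Q [EPA cd]]]] := longpath_first E3 lPA.
have [x [y [Z [EZ xy]]]] := longpath_last E3 lZ.
(* Closes up from the last pair of the long path to the first pair of [PA]. *)
have : has (connector E ((x, y), (c, d))) L'.
  rewrite has_count; have := cL (connector E ((x, y), (c, d))).
  have := HL ((x, y), (c, d)); rewrite size_map; move: sT; count_lia.
move=> /hasP[s sL2]; rewrite /connector /= xy cd /= => Ts.
have T1 : tpath (edge E) (PA ++ flatten S ++ s ++ [:: c; d]).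
  have -> : PA ++ flatten S ++ s ++ [:: c; d] = Z ++ x :: y :: (s ++ [:: c; d]).
    have -> : Z ++ x :: y :: (s ++ [:: c; d]) = (Z ++ [:: x; y]) ++ s ++ [:: c; d].
      by rewrite -catA.
    by rewrite -EZ /= -catA.
  by rewrite tpath_glue -EZ; move/andP: lZ => [-> _]; rewrite andTb.
have cL' (q : pred 'I_n) : count q (flatten L') = count q s + count q (flatten (rem s L')).
  by rewrite !count_flatten_sum (perm_big _ (perm_to_rem sL2)) big_cons.
have [|P' [TP' pP' tP']] := absorb_all (X := U ++ flatten (rem s L')) T1.
  move=> v; apply: leq_trans (leq_trans (HB v) (cP (absorbs E v))).
  have : size (flatten (rem s L')) <= size (flatten L').
    by rewrite -!count_predT cL' leq_addl.
  have : w <= l * r * w by rewrite leq_pmull.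
  have -> : 2 * (l * r) * w = 2 * (l * r * w) by exact: (esym (mulnA _ _ _)).
  rewrite size_cat; move: sU sL'; rewrite szL; move: (l * r * w); count_lia.
have {}tP' := etrans tP' (congr1 (take 2) EPA); rewrite /= take0 in tP'.
have [P0 EP'] : exists P0, P' = c :: d :: P0.
  by case: (P') tP' => [|? [|? P0]] //= [-> ->]; exists P0.
apply: (@cycle_ham _ E (P' ++ flatten S ++ s)) => //; last first.
  have -> : take 2 (P' ++ flatten S ++ s) = [:: c; d] by rewrite EP' /= take0.
  by rewrite -!catA.
apply/permP => q; rewrite -(permP pE) !count_cat.
have := permP pZ q; rewrite (permP pP') /= !count_cat cL' (permP ptw) -/PA.
count_lia.
Qed.

Theorem theorem1p4 (R : realType) (alpha : R) :
  (0 < alpha)%R ->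
  exists n0 : nat, forall n : nat, (n0 <= n)%N ->
    forall E : {set {set 'I_n}}, is_3graph E ->
      (forall i j : 'I_n, i != j ->
         (Num.min (i.+1%:R : R) (Num.min (j.+1%:R) (n%:R / 2%:R)) + alpha * n%:R
            <= (pair_deg E i j)%:R)%R) ->
      tight_ham_cycle E.
Proof.
move=> alpha0.
have [k k0 Hk] : exists2 k : nat, 0 < k & (1 <= alpha * k%:R)%R.
  exists (Num.bound alpha^-1).+1 => //.
  rewrite mulrC -ler_pdivrMr // mul1r; apply: ltW.
  apply: lt_le_trans (archi_boundP _) _; first by rewrite invr_ge0 ltW.
  by rewrite ler_nat.
have K0 : 0 < 16 * k by rewrite muln_gt0.
have [N1 HN1] := posa_tight_ham K0.
exists (N1 + 8 * k) => n Nn E E3 degE.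
have n1 : N1 <= n by apply: leq_trans Nn; rewrite leq_addr.
have n2 : 8 * k <= n by apply: leq_trans Nn; rewrite leq_addl.
have k8 : 0 < 8 * k by rewrite muln_gt0.
(* Since [k] is at least [1/alpha], [8 f] is at most [alpha n]; since [n] is at least [8 k],
   rounding loses at most a factor 2, whence [K = 16 k]. *)
set f := n %/ (8 * k).
have f0 : 0 < f by rewrite divn_gt0.
have nf : n <= 16 * k * f.
  have := ltn_ceil n k8; rewrite -/f mulSn => h; apply: leq_trans (ltnW h) _.
  have : 8 * k <= f * (8 * k) by rewrite leq_pmull.
  have -> : 16 * k * f = 2 * (f * (8 * k)) by ring.
  by move: (f * _); clear; lia.
apply: (HN1 n n1 E f) => // i j ij.
have fn : k * (8 * f) <= n.
  by apply: leq_trans (leq_trunc_div n (8 * k)); rewrite -/f; apply: eq_leq; ring.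
rewrite -(ler_nat R); apply: le_trans (degE i j ij); rewrite natrD.
apply: lerD.
  (* Passing from [i+1] to the index [i] and from [n/2] to its floor only lowers the minimum. *)
  rewrite !le_min !ler_nat ler_pdivlMr ?ltr0n // -natrM ler_nat.
  by clear; lia.
apply: (@le_trans _ _ (alpha * k%:R * (8 * f)%:R)%R).
  by rewrite ler_peMl // ler0n.
by rewrite -mulrA -natrM ler_wpM2l ?ler_nat // ltW.
Qed.
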